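(* Let $\mathcal{G}$ be an ultragraph and $K$ a field. Then $L_K(\mathcal{G})$ is simple if and only if $\mathcal{G}$ satisfies Condition (L) and $\mathcal{G}^0$ and $\emptyset$ are the only saturated hereditary subsets of $\mathcal{G}^0$.
   Context: Ultragraph: $\mathcal{G}=(G^0,\mathcal{G}^1,r,s)$ with countable sets $G^0$ (vertices), $\mathcal{G}^1$ (edges), a source map $s:\mathcal{G}^1\to G^0$ and a range map $r:\mathcal{G}^1\to\mathcal{P}(G^0)\setminus\{\emptyset\}$. $\mathcal{G}^0$ is the smallest subset of $\mathcal{P}(G^0)$ containing all $\{v\}$ ($v\in G^0$) and all $r(e)$ ($e\in\mathcal{G}^1$) and closed under finite unions, finite intersections and relative complements. A sink is a vertex $v$ with $s^{-1}(v)=\emptyset$; a vertex is singular if $|s^{-1}(v)|\in\{0,\infty\}$. Leavitt path algebra: a Leavitt $\mathcal{G}$-family in a (not necessarily unital) $K$-algebra $\mathcal{A}$ is a set $\{P_A,S_e,S_{e^*}\}_{A\in\mathcal{G}^0,e\in\mathcal{G}^1}\subseteq\mathcal{A}$ with (uLP1) $P_\emptyset=0$, $P_{A\cap B}=P_AP_B$, $P_{A\cup B}=P_A+P_B-P_{A\cap B}$ for all $A,B\in\mathcal{G}^0$; (uLP2) $P_{s(e)}S_e=S_eP_{r(e)}=S_e$ and $P_{r(e)}S_{e^*}=S_{e^*}P_{s(e)}=S_{e^*}$ for all $e\in\mathcal{G}^1$; (uLP3) $S_{e^*}S_f=\delta_{e,f}P_{r(e)}$ for all $e,f\in\mathcal{G}^1$;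 (uLP4) $P_v=\sum_{e\in s^{-1}(v)}S_eS_{e^*}$ whenever $0<|s^{-1}(v)|<\infty$ (where $P_v:=P_{\{v\}}$). $L_K(\mathcal{G})$ is the $K$-algebra generated by a universal Leavitt $\mathcal{G}$-family $\{p_A,s_e,s_{e^*}\}$: for every Leavitt $\mathcal{G}$-family $\{P_A,S_e,S_{e^*}\}$ in a $K$-algebra $\mathcal{A}$ there is a $K$-algebra homomorphism $L_K(\mathcal{G})\to\mathcal{A}$ with $p_A\mapsto P_A$, $s_e\mapsto S_e$, $s_{e^*}\mapsto S_{e^*}$. Simple means that the only two-sided ideals are $\{0\}$ and the whole algebra. Condition (L): a cycle is a path $\alpha=e_1\cdots e_n$ of edges ($n\ge1$, $s(e_{i+1})\in r(e_i)$ for $1\le i\le n-1$) with $s(e_1)\in r(e_n)$. An edge $e$ is an exit for $\alpha$ if there is an $i$ such that $s(e)=s(e_i)$ and $e\neq e_i$. $\mathcal{G}$ satisfies Condition (L) if every cycle $\alpha=e_1\cdots e_n$ in $\mathcal{G}$ has an exit, or there is an $i$ such that $r(e_i)$ contains a sink. $H\subseteq\mathcal{G}^0$ is hereditary if: (1) for each $e\in\mathcal{G}^1$, $\{s(e)\}\in H\Rightarrow r(e)\in H$; (2) $A,B\in H\Rightarrow A\cup B\in H$; (3) $A\in H$, $B\in\mathcal{G}^0$, $B\subseteq A\Rightarrow B\in H$. $H\subseteq\mathcal{G}^0$ is saturated if for every non-singular vertex $v\in G^0$, $\{r(e):e\in\mathcal{G}^1,\ s(e)=v\}\subseteq H$ implies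 $\{v\}\in H$.
   Formalization: An exit for e_1⋯e_n is taken as an edge e with s(e)∈r(e_i), e≠e_{i+1} (indices mod n), since with s(e)=s(e_i), e≠e_i the claim fails (e: v→{v,w}, f: w→{v}); and {∅}, always saturated hereditary, is counted as trivial along with ∅. *)

(* Defs.v *)
From HB Require Import structures.
From mathcomp Require Import all_boot all_order all_algebra.
From mathcomp Require Import boolp classical_sets functions cardinality fsbigop.

Set Implicit Arguments.
Unset Strict Implicit.
Unset Printing Implicit Defensive.

Import GRing.Theory.

Local Open Scope classical_set_scope.
Local Open Scope ring_scope.

(* MathComp's algebras all have a unit, whereas [L_K(G)] need not have one. *)
HB.mixin Record isNonUnitalAlgebra (K : fieldType) A of GRing.Lmodule K A := {
  numul : A -> A -> A;
  numulA : associative numul;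
  numulDl : left_distributive numul +%R;
  numulDr : right_distributive numul +%R;
  numulZl : forall (k : K) (x y : A), numul (k *: x) y = k *: numul x y;
  numulZr : forall (k : K) (x y : A), numul x (k *: y) = k *: numul x y
}.

#[short(type="nuAlgType")]
HB.structure Definition NonUnitalAlgebra (K : fieldType) :=
  { A of GRing.Lmodule K A & isNonUnitalAlgebra K A }.

Notation "x ** y" := (numul x y) (at level 40, left associativity) : ring_scope.

Section Algebra.
Variable K : fieldType.

Definition multiplicative_map (A B : nuAlgType K) (f : A -> B) : Prop :=
  forall x y, f (x ** y) = f x ** f y.

Definition subspace_set (A : nuAlgType K) (I : set A) : Prop :=
  [/\ I 0, (forall x y, I x -> I y -> I (x + y))
    & forall (k : K) x, I x -> I (k *: x)].

Definition subalgebra (A : nuAlgType K) (B : set A) : Prop :=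
  subspace_set B /\ forall x y, B x -> B y -> B (x ** y).

Definition two_sided_ideal (A : nuAlgType K) (I : set A) : Prop :=
  subspace_set I /\ forall a x, I x -> I (a ** x) /\ I (x ** a).

Definition simple_algebra (A : nuAlgType K) : Prop :=
  forall I : set A, two_sided_ideal I -> I = [set 0] \/ I = setT.

End Algebra.

Record ultragraph := Ultragraph {
  vertex : countType;
  edge : countType;
  src : edge -> vertex;
  rng : edge -> set vertex;
  rng_neq0 : forall e, rng e !=set0
}.

Section Ultragraph.
Variable G : ultragraph.
Implicit Types (A B : set (vertex G)) (H : set (set (vertex G))).
Implicit Types (v : vertex G) (e f : edge G).

Definition out_edges v : set (edge G) := [set e | src e = v].

Definition sink v : Prop := out_edges v = set0.

Definition singular v : Prop :=
  out_edges v = set0 \/ infinite_set (out_edges v).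

(* The paper's [\mathcal{G}^0].  The empty set is the empty union; it is
   automatically there as soon as [G] has a vertex. *)
Definition gen_vertices : set (set (vertex G)) :=
  smallest
    [set M : set (set (vertex G)) |
      [/\ M set0, setU_closed M, setI_closed M
        & forall A B, M A -> M B -> M (A `\` B)]]
    ([set [set v] | v in setT] `|` [set rng e | e in setT]).

(* [a 0, ..., a n] is the cycle; [ordS] is the successor modulo [n.+1], so this
   covers both the path condition and the closing one. *)
Definition is_cycle n (a : 'I_n.+1 -> edge G) : Prop :=
  forall i, rng (a i) (src (a (ordS i))).

(* Since [src (a (ordS i))] is in [rng (a i)], every edge [e] with
   [src e = src (a i)] and [e <> a i] is an exit (at the predecessor of [i]),
   and conversely if the ranges are singletons.  For larger ranges the exits
   based at the other vertices of [rng (a i)] are needed: with two vertices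
   [v], [w] and two edges [e : v -> {v, w}], [f : w -> {v}], the cycle [e] is
   left only through [f], but the Leavitt path algebra is simple. *)
Definition is_exit n (a : 'I_n.+1 -> edge G) e : Prop :=
  exists i, rng (a i) (src e) /\ e <> a (ordS i).

Definition conditionL : Prop :=
  forall n (a : 'I_n.+1 -> edge G), is_cycle a ->
    (exists e, is_exit a e) \/ (exists i w, rng (a i) w /\ sink w).

Definition hereditary H : Prop :=
  [/\ forall e, H [set src e] -> H (rng e),
      forall A B, H A -> H B -> H (A `|` B)
    & forall A B, H A -> gen_vertices B -> B `<=` A -> H B].

Definition saturated H : Prop :=
  forall v, ~ singular v ->
    [set rng e | e in out_edges v] `<=` H -> H [set v].

Section Families.
Variable K : fieldType.

(* Families are total functions [P] on all sets of vertices; only the values on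
   [gen_vertices] are part of the family.  [S e] is S_e and [T e] is S_{e^*}. *)
Definition leavitt_family (A : nuAlgType K)
    (P : set (vertex G) -> A) (S T : edge G -> A) : Prop :=
  [/\ [/\ P set0 = 0,
          forall B C, gen_vertices B -> gen_vertices C ->
            P (B `&` C) = P B ** P C
        & forall B C, gen_vertices B -> gen_vertices C ->
            P (B `|` C) = P B + P C - P (B `&` C)],
      forall e,
        [/\ P [set src e] ** S e = S e, S e ** P (rng e) = S e,
            P (rng e) ** T e = T e & T e ** P [set src e] = T e],
      forall e f, T e ** S f = if e == f then P (rng e) else 0
    & forall v, ~ singular v ->
        P [set v] = \sum_(e \in out_edges v) (S e ** T e)].

Definition generated_by (A : nuAlgType K)
    (P : set (vertex G) -> A) (S T : edge G -> A) : Prop :=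
  forall B : set A, subalgebra B ->
    (forall C, gen_vertices C -> B (P C)) ->
    (forall e, B (S e) /\ B (T e)) -> B = setT.

(* [L], together with [p], [s] and [t], is the Leavitt path algebra L_K(G). *)
Definition is_leavitt_path_algebra (L : nuAlgType K)
    (p : set (vertex G) -> L) (s t : edge G -> L) : Prop :=
  [/\ leavitt_family p s t, generated_by p s t
    & forall (A : nuAlgType K) (P : set (vertex G) -> A) (S T : edge G -> A),
        leavitt_family P S T ->
        exists f : {linear L -> A},
          [/\ multiplicative_map f,
              forall B, gen_vertices B -> f (p B) = P B
            & forall e, f (s e) = S e /\ f (t e) = T e]].

End Families.
End Ultragraph.

(* Main.v *)
(** Boundary points of [G] - infinite paths, or finite paths ended by an
    ultrafilter of sets of vertices that contains no nonsingular vertex - form a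
    branching system, so [L_K(G)] acts on the functions on them.  Letting the
    points avoid a saturated hereditary [H] gives a representation that kills
    [p_A] exactly for [A] in [H]; hence a simple [L_K(G)] forces [H] to be
    trivial.  If a cycle [c] at [v] cannot be left, [p_v] and [s_c] agree in the
    ungraded representation and differ in the one graded by [int], so
    [p_v - s_c] generates a proper nonzero ideal.

    Conversely let [I] be a nonzero ideal.  Multiplying an element of [I] by
    suitable [s_e] removes its ghost edges; a shortest remaining sum of terms
    [s_a p_A], multiplied by [t_a] for its shortest path [a] and cut down to a
    vertex [v], becomes [p_v + sum k_i s_(g_i)] with closed paths [g_i] at [v].
    Condition (L) provides a path [d] from [v] that either ends with an exit and
    is not a prefix of any [g_i d], or reaches a sink; compressing with [d]
    leaves some [p_A] with [A] nonempty in [I].  Then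
    [{A | p_A in I}], being saturated and hereditary, is everything. *)

From HB Require Import structures.
Require Import Defs.
From mathcomp Require Import all_boot all_order all_algebra.
From mathcomp Require Import boolp classical_sets functions cardinality fsbigop.
From mathcomp Require Import filter zify.

Set Implicit Arguments.
Unset Strict Implicit.
Unset Printing Implicit Defensive.

Import GRing.Theory.

Local Open Scope classical_set_scope.
Local Open Scope ring_scope.

(** * Linear operators on spaces of functions *)

Section EndoFun.
Variables (K : fieldType) (X : Type).

(** Under composition these operators form the non-unital algebra in which all representations below
    take their values. Linearity is stated value by value, ready for rewriting at a point. *)
Record endofun := Endofun {
  endofun_val :> (X -> K) -> X -> K;
  endofun_lin : forall k phi psi x,
    endofun_val (fun y => k * phi y + psi y) x
    = k * endofun_val phi x + endofun_val psi x }.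

Implicit Types f g h : endofun.

Lemma endofunP f g : (forall phi x, f phi x = g phi x) -> f = g.
Proof.
case: f g => [f lf] [g lg] /= fg.
have e : f = g by apply/funext => phi; apply/funext => x; apply: fg.
by case: _ / e lg => lg; congr Endofun; apply: Prop_irrelevance.
Qed.

Fact endofun0_subproof k (phi psi : X -> K) (x : X) : 0 = k * 0 + 0 :> K.
Proof. by rewrite mulr0 addr0. Qed.
Definition endofun0 :=
  @Endofun (fun _ _ => 0) endofun0_subproof.

Fact endofunD_subproof f g k phi psi x :
  f (fun y => k * phi y + psi y) x + g (fun y => k * phi y + psi y) x
  = k * (f phi x + g phi x) + (f psi x + g psi x).
Proof. by rewrite !endofun_lin mulrDr addrACA. Qed.
Definition endofunD f g :=
  @Endofun (fun phi x => f phi x + g phi x) (endofunD_subproof f g).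

Fact endofunZ_subproof c f k phi psi x :
  c * f (fun y => k * phi y + psi y) x
  = k * (c * f phi x) + c * f psi x.
Proof. by rewrite !endofun_lin mulrDr mulrCA. Qed.
Definition endofunZ c f :=
  @Endofun (fun phi x => c * f phi x) (endofunZ_subproof c f).

Fact endofunM_subproof f g k phi psi x :
  f (g (fun y => k * phi y + psi y)) x = k * f (g phi) x + f (g psi) x.
Proof.
by rewrite -endofun_lin; congr (f _ x); apply/funext => y; rewrite endofun_lin.
Qed.
Definition endofunM f g :=
  @Endofun (fun phi x => f (g phi) x) (endofunM_subproof f g).

HB.instance Definition _ := gen_eqMixin endofun.
HB.instance Definition _ := gen_choiceMixin endofun.

Fact endofunDA : associative endofunD.
Proof. by move=> f g h; apply: endofunP => phi x /=; rewrite addrA. Qed.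
Fact endofunDC : commutative endofunD.
Proof. by move=> f g; apply: endofunP => phi x /=; rewrite addrC. Qed.
Fact endofun0D : left_id endofun0 endofunD.
Proof. by move=> f; apply: endofunP => phi x /=; rewrite add0r. Qed.
Fact endofunND : left_inverse endofun0 (endofunZ (-1)) endofunD.
Proof. by move=> f; apply: endofunP => phi x /=; rewrite mulN1r addNr. Qed.

HB.instance Definition _ := GRing.isZmodule.Build endofun
  endofunDA endofunDC endofun0D endofunND.

Fact endofunZA a b f : endofunZ a (endofunZ b f) = endofunZ (a * b) f.
Proof. by apply: endofunP => phi x /=; rewrite mulrA. Qed.
Fact endofunZ1 : left_id 1 endofunZ.
Proof. by move=> f; apply: endofunP => phi x /=; rewrite mul1r. Qed.
Fact endofunZDr : right_distributive endofunZ +%R.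
Proof. by move=> k f g; apply: endofunP => phi x /=; rewrite mulrDr. Qed.
Fact endofunZDl f : {morph endofunZ^~ f : a b / a + b}.
Proof. by move=> a b; apply: endofunP => phi x /=; rewrite mulrDl. Qed.

HB.instance Definition _ := GRing.Zmodule_isLmodule.Build K endofun
  endofunZA endofunZ1 endofunZDr endofunZDl.

Fact endofunMA : associative endofunM.
Proof. by move=> f g h; apply: endofunP. Qed.
Fact endofunMDl : left_distributive endofunM +%R.
Proof. by move=> f g h; apply: endofunP. Qed.
Fact endofunMDr : right_distributive endofunM +%R.
Proof.
move=> f g h; apply: endofunP => phi x /=.
rewrite -[f (g phi) x]mul1r -endofun_lin; congr (f _ x).
by apply/funext => y; rewrite mul1r.
Qed.
Fact endofunMZl k f g : endofunM (k *: f) g = k *: endofunM f g.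
Proof. exact: endofunP. Qed.
Fact endofunMZr k f g : endofunM f (k *: g) = k *: endofunM f g.
Proof.
apply: endofunP => phi x /=.
(* Coefficient -1 in the linearity law gives f(0) = - f(0) + f(0). *)
have f0 : f (fun=> 0) x = 0.
  have := endofun_lin f (-1) (fun=> 0) (fun=> 0) x.
  by rewrite mulr0 addr0 mulN1r addNr.
rewrite -[RHS]addr0 -[X in _ + X]f0 -endofun_lin; congr (f _ x).
by apply/funext => y; rewrite addr0.
Qed.

HB.instance Definition _ := isNonUnitalAlgebra.Build K endofun
  endofunMA endofunMDl endofunMDr endofunMZl endofunMZr.

Lemma endofun_sumE (I : Type) (r : seq I) (F : I -> endofun) phi x :
  (\sum_(i <- r) F i) phi x = \sum_(i <- r) F i phi x.
Proof. by elim/big_rec2: _ => //= i y1 y2 _ <-. Qed.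

End EndoFun.

Lemma not_singular_seq (G : ultragraph) (v : vertex G) : ~ singular v ->
  exists2 r : seq (edge G), uniq r & out_edges v = [set` r].
Proof.
move=> nv; have /finite_seqP[r vr] : finite_set (out_edges v).
  by apply: contrapT => inf; apply: nv; right.
exists (undup r); first exact: undup_uniq.
by rewrite vr; apply/seteqP; split=> e /=; rewrite mem_undup.
Qed.

(** * Leavitt families from branching systems *)

Section BranchingSystem.
Variables (G : ultragraph) (K : fieldType) (X : Type).
Variables (D : set (vertex G) -> set X) (R : edge G -> set X).
Variables (c : edge G -> X -> X) (g : X -> X).
Hypotheses (D0 : D set0 = set0)
  (DI : forall A B, D (A `&` B) = D A `&` D B)
  (DU : forall A B, D (A `|` B) = D A `|` D B)
  (RD : forall e, R e `<=` D [set src e])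
  (cR : forall e x, D (rng e) x -> R e (c e x))
  (cK : forall e x, D (rng e) x -> g (c e x) = x)
  (gD : forall e x, R e x -> D (rng e) (g x))
  (gK : forall e x, R e x -> c e (g x) = x)
  (R_inj : forall e f x, R e x -> R f x -> e = f)
  (D_cover : forall v x, ~ singular v -> D [set v] x ->
    exists2 e, src e = v & R e x).

Lemma partial_pullback_lin (E : set X) (h : X -> X) (k : K) phi psi x :
  (if `[< E x >] then k * phi (h x) + psi (h x) else 0)
  = k * (if `[< E x >] then phi (h x) else 0)
    + (if `[< E x >] then psi (h x) else 0).
Proof. by case: ifP; rewrite ?mulr0 ?addr0. Qed.

(** Composition with [h], extended by zero outside [E]. Below, [branchS e] and [branchT e] pull back
    along [g] and [c e], which are inverse bijections between [R e] and [D (rng e)]. *)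
Definition partial_pullback (E : set X) (h : X -> X) : endofun K X :=
  Endofun (@partial_pullback_lin E h).

Definition branchP (A : set (vertex G)) := partial_pullback (D A) id.
Definition branchS (e : edge G) := partial_pullback (R e) g.
Definition branchT (e : edge G) := partial_pullback (D (rng e)) (c e).

(** Each relation between operators reflects one between sets. In particular the Cuntz-Krieger
    relation at a nonsingular [v] holds because the disjoint sets [R e], with [e] leaving [v],
    partition [D [set v]]. *)
Lemma branching_family : leavitt_family branchP branchS branchT.
Proof.
split; first split.
- by apply: endofunP => phi x /=; rewrite D0; case: asboolP.
- move=> B C _ _; apply: endofunP => phi x /=; rewrite DI asbool_and.
  by case: `[< D B x >].
- move=> B C _ _; apply: endofunP => phi x /=.
  rewrite DU DI asbool_and asbool_or mulN1r.
  by case: `[< D B x >] => /=; case: `[< D C x >] => /=;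
    rewrite ?addrK ?subr0 ?addr0 ?add0r.
- move=> e; split; apply: endofunP => phi x /=.
  + case: (asboolP (R e x)) => [Rx|_]; last by case: asboolP.
    by case: asboolP => // -[]; apply: RD.
  + case: asboolP => // Rx; case: asboolP => // -[].
    exact: gD.
  + by case: asboolP.
  + case: asboolP => // Dx; case: asboolP => // -[].
    by apply: RD; apply: cR.
- move=> e f; case: eqP => [<-|ef]; apply: endofunP => phi x /=.
  + case: asboolP => // Dx; rewrite cK //; case: asboolP => // -[].
    exact: cR.
  + case: asboolP => // Dx; case: asboolP => // Rx; case: ef.
    by apply: R_inj Rx; apply: cR.
- move=> v nv; apply: endofunP => phi x.
  have [r ur vr] := not_singular_seq nv.
  rewrite vr -fsbig_seq //= endofun_sumE /=.
  (* The product of [branchS e] and [branchT e] is multiplication by the indicator function of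
     [R e]. *)
  have ST e : (if `[< R e x >] then
      if `[< D (rng e) (g x) >] then phi (c e (g x)) else 0 else 0)
      = if `[< R e x >] then phi x else 0.
    case: asboolP => // Rx; rewrite gK //; case: asboolP => // -[].
    exact: gD.
  under eq_bigr do rewrite ST.
  case: asboolP => [Dx|nDx].
    have [e ev Rx] := D_cover nv Dx.
    have ein : e \in r by have : out_edges v e by []; rewrite vr.
    rewrite (bigD1_seq e ein ur) /=.
    rewrite asboolT // big1 ?addr0 // => f /eqP fe.
    by case: asboolP => // Rfx; case: fe; apply: R_inj Rfx Rx.
  rewrite big1_seq // => e /= er.
  have ev : src e = v by have : [set` r] e by []; rewrite -vr.
  by case: asboolP => // Rx; case: nDx; rewrite -ev; apply: RD.
Qed.

End BranchingSystem.

(** * Boundary points *)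

Section GenVertices.
Variable G : ultragraph.
Implicit Types (A B : set (vertex G)) (H : set (set (vertex G))).

Lemma gen_vertices0 : @gen_vertices G set0.
Proof. by move=> M [[M0]]. Qed.

Lemma gen_vertices1 (v : vertex G) : gen_vertices [set v].
Proof. by move=> M [_ MG]; apply: MG; left; exists v. Qed.

Lemma gen_verticesr (e : edge G) : gen_vertices (rng e).
Proof. by move=> M [_ MG]; apply: MG; right; exists e. Qed.

Lemma gen_verticesU A B :
  gen_vertices A -> gen_vertices B -> gen_vertices (A `|` B).
Proof.
by move=> gA gB M MG; have [[_ MU _ _] _] := MG; apply: MU; [exact: gA|exact: gB].
Qed.

Lemma gen_verticesI A B :
  gen_vertices A -> gen_vertices B -> gen_vertices (A `&` B).
Proof.
by move=> gA gB M MG; have [[_ _ MI _] _] := MG; apply: MI; [exact: gA|exact: gB].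
Qed.

Lemma gen_verticesD A B :
  gen_vertices A -> gen_vertices B -> gen_vertices (A `\` B).
Proof.
by move=> gA gB M MG; have [[_ _ _ MD] _] := MG; apply: MD; [exact: gA|exact: gB].
Qed.

Lemma not_singular_out (v : vertex G) : ~ singular v -> out_edges v !=set0.
Proof.
by move=> nv; apply: contrapT => /nonemptyPn v0; apply: nv; left.
Qed.

(** With [[set set0]] in the place of [H], the boundary representation kills no projection of a
    nonempty set. *)
Lemma hereditary1 : hereditary [set (@set0 (vertex G))].
Proof.
split=> [e /= /seteqP[/(_ _ erefl)] //|A B /= -> ->|A B /= -> _].
  by rewrite setU0.
by rewrite subset0.
Qed.

Lemma saturated1 : saturated [set (@set0 (vertex G))].
Proof.
move=> v nv vH; have [e ve] := not_singular_out nv.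
have [w ew] := rng_neq0 e; have /= e0 : [set set0] (rng e) by apply: vH; exists e.
by rewrite e0 in ew.
Qed.

End GenVertices.

Section BoundaryPoints.
Variables (G : ultragraph) (H : set (set (vertex G))).
Hypotheses (H0 : H set0) (hH : hereditary H) (sH : saturated H).

(* An ultrafilter of sets of vertices plays the role of the last vertex of a
   finite boundary path; non-principal ones are needed as soon as some member
   of [gen_vertices] not in [H] consists of vertices [v] with [[set v]] in [H]. *)
Definition letter : Type := edge G + set_system (vertex G).

(** An edge gives the principal ultrafilter at its source, so every letter is based at a vertex,
    possibly an ideal one. *)
Definition base (l : letter) : set_system (vertex G) :=
  match l with inl e => [set A | A (src e)] | inr U => U end.

(** Keeping nonsingular vertices out of [U] lets a path end only where the Cuntz-Krieger relation
    does not force it to go on. *)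
Definition admissible (l : letter) : Prop :=
  match l with
  | inl e => ~ H (rng e)
  | inr U => [/\ UltraFilter U, forall B, H B -> ~ U B
               & forall v, ~ singular v -> ~ U [set v]]
  end.

(* Nothing is required of the letters that follow a terminal one. *)
Definition boundary (x : nat -> letter) : Prop :=
  forall n, admissible (x n) /\
    (forall e, x n = inl e -> base (x n.+1) (rng e)).

(** Heredity passes from [B] to the source of the edge, and from there to its range. *)
Lemma admissible_base l : admissible l -> forall B, H B -> ~ base l B.
Proof.
have [Hr _ Hs] := hH.
case: l => [e|U] /= => [nHe B HB Be|[] //].
by apply: nHe; apply: Hr; apply: Hs HB (gen_vertices1 _) _ => _ ->.
Qed.

Lemma base0 l : admissible l -> ~ base l set0.
Proof. by move=> al; apply: admissible_base al _ H0. Qed.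

Lemma baseI l A B : admissible l -> base l (A `&` B) <-> base l A /\ base l B.
Proof.
case: l => [e _ //|U [UU _ _]] /=; split => [UAB|[UA UB]]; last exact: filterI.
by split; apply: filterS UAB => v [].
Qed.

Lemma baseU l A B : admissible l -> base l (A `|` B) <-> base l A \/ base l B.
Proof.
case: l => [e _ //|U [UU _ _]] /=; split => [UAB|[]]; last 2 first.
- by apply: filterS => v; left.
- by apply: filterS => v; right.
have [UA|UA] := in_ultra_setVsetC A UU; first by left.
by right; apply: filterS (filterI UAB UA) => v [[]].
Qed.

(** The sets [A] minus [B], for [B] in [H], are a filter base: [H] is closed under unions, and none
    of them is empty because [A] is not in the hereditary [H]. Any ultrafilter above it will do. *)
Lemma exists_ultrafilter A : gen_vertices A -> ~ H A ->
  exists U : set_system (vertex G),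
    [/\ UltraFilter U, U A & forall B, H B -> ~ U B].
Proof.
have [_ HU Hs] := hH.
move=> gA nHA.
pose F := filter_from H (fun B => A `\` B).
have FF : Filter F.
  apply: filter_from_filter; first by exists set0.
  by move=> B C HB HC; exists (B `|` C); [apply: HU|rewrite setDUr].
have FP : ProperFilter F.
  apply: filter_from_proper => B HB; apply: contrapT => /nonemptyPn.
  by rewrite setD_eq0 => AB; apply: nHA; apply: Hs AB.
have [U [UU FU]] := ultraFilterLemma FP; exists U; split => // [|B HB UB].
  by apply: FU; exists set0; rewrite ?setD0.
have UAB : U (A `\` B) by apply: FU; exists B.
apply: (@filter_not_empty _ U _).
by apply: filterS (filterI UAB UB) => v [[]].
Qed.

(** If the ultrafilter contains a nonsingular vertex [v], it is replaced by an edge leaving [v] with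
    range outside [H]; saturation provides this edge. *)
Lemma exists_letter A : gen_vertices A -> ~ H A ->
  exists2 l, admissible l & base l A.
Proof.
move=> gA nHA; have [U [UU UA UH]] := exists_ultrafilter gA nHA.
have [[v [nv Uv]]|nU] := pselect (exists v, ~ singular v /\ U [set v]); last first.
  by exists (inr U) => //; split => // v nv Uv; apply: nU; exists v.
have Av : A v.
  by have [w [Aw /= <-]] := filter_ex (filterI UA Uv).
have [e ve nHe] : exists2 e, src e = v & ~ H (rng e).
  apply: contrapT => no; apply: UH Uv; apply: sH => // _ [e ve <-].
  by apply: contrapT => nHe; apply: no; exists e.
by exists (inl e) => //=; rewrite ve.
Qed.

(** Letters are chosen one after another: the range of an admissible edge is outside [H], so a next
    letter based in it exists. *)
Lemma exists_boundary A : gen_vertices A -> ~ H A ->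
  exists2 x, boundary x & base (x 0%N) A.
Proof.
move=> gA nHA.
have [pick pickP] : exists pick : set (vertex G) -> letter, forall B,
    gen_vertices B -> ~ H B -> admissible (pick B) /\ base (pick B) B.
  have /choice : forall B : set (vertex G), exists l,
    gen_vertices B -> ~ H B -> admissible l /\ base l B.
    move=> B; have [[gB nB]|nB] := pselect (gen_vertices B /\ ~ H B).
      by have [l al lB] := exists_letter gB nB; exists l.
    (* A dummy letter, for sets about which nothing is claimed. *)
    by exists (inr set0) => gB nHB; case: nB.
  by case=> pick pickP; exists pick.
(* A terminal letter is repeated forever, so that all letters stay admissible. *)
pose next (l : letter) : letter := if l is inl e then pick (rng e) else l.
exists (fun n => iter n next (pick A)); last by have [] := pickP A gA nHA.
have adm n : admissible (iter n next (pick A)).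
  elim: n => [|n IHn] /=; first by have [] := pickP A gA nHA.
  move: IHn; case: (iter _ _ _) => //= e nHe.
  by have [] := pickP _ (gen_verticesr e) nHe.
move=> n; split=> // e /= ne; rewrite ne /=.
have := adm n; rewrite ne /= => nHe.
by have [] := pickP _ (gen_verticesr e) nHe.
Qed.

Definition tail (x : nat -> letter) : nat -> letter := fun n => x n.+1.

Definition cons_edge (e : edge G) (x : nat -> letter) : nat -> letter :=
  fun n => if n is m.+1 then x m else inl e.

Lemma boundary_tail x : boundary x -> boundary (tail x).
Proof. by move=> bx n; apply: bx. Qed.

Lemma boundary_cons e x : boundary x -> base (x 0%N) (rng e) ->
  boundary (cons_edge e x).
Proof.
move=> bx xe [|n] /=; last exact: bx.
split=> [He|f [<-] //]; have [ax _] := bx 0%N.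
exact: admissible_base He xe.
Qed.

(* The second component records degrees: it makes the operators of [S e] and
   [T e] homogeneous of degree [d] and [- d]. *)
Definition point : Type := (nat -> letter) * int.

Variables (K : fieldType) (d : int).

Definition pointD A : set point := [set z | boundary z.1 /\ base (z.1 0%N) A].
Definition pointR e : set point := [set z | boundary z.1 /\ z.1 0%N = inl e].
Definition point_cons e (z : point) : point := (cons_edge e z.1, z.2 + d).
Definition point_tail (z : point) : point := (tail z.1, z.2 - d).

Definition pointP : set (vertex G) -> endofun K point := branchP K pointD.
Definition pointS : edge G -> endofun K point := branchS K pointR point_tail.
Definition pointT : edge G -> endofun K point := branchT K pointD point_cons.

Lemma cons_tail e x : x 0%N = inl e -> cons_edge e (tail x) = x.
Proof. by move=> xe; apply/funext => -[]. Qed.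

(** Prepending an edge and deleting the first letter are inverse to each other. The covering
    condition holds because no terminal letter contains a nonsingular vertex. *)
Lemma point_family : leavitt_family pointP pointS pointT.
Proof.
apply: branching_family.
- by apply/seteqP; split=> // z [bz]; apply: base0; have [] := bz 0%N.
- move=> A B; apply/seteqP; split=> [z [bz]|z [[bz zA] [_ zB]]].
    by move=> /baseI[|zA zB]; [have [] := bz 0%N|].
  by split=> //; apply/baseI; [have [] := bz 0%N|].
- move=> A B; apply/seteqP; split=> [z [bz]|z [[bz zA]|[bz zB]]].
  + by move=> /baseU[|zA|zB]; [have [] := bz 0%N|left|right].
  + by split=> //; apply/baseU; [have [] := bz 0%N|left].
  + by split=> //; apply/baseU; [have [] := bz 0%N|right].
- by move=> e z [bz ze]; split=> //; rewrite ze.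
- by move=> e z [bz ze]; split=> //; apply: boundary_cons.
- by move=> e [x k] [bz ze]; congr pair; rewrite addrK.
- by move=> e z [bz ze]; split; [apply: boundary_tail|apply: (bz 0%N).2].
- by move=> e [x k] [bz ze]; congr pair; rewrite ?subrK ?cons_tail.
- by move=> e f z [_ ze] [_]; rewrite ze => -[].
- move=> v z nv [bz]; have [] := bz 0%N; case zE : (z.1 0%N) => [e|U] /=.
    by move=> _ _ ev; exists e.
  by move=> [_ _ /(_ _ nv) nUv] _ /nUv.
Qed.

End BoundaryPoints.

(** * Leavitt families *)

Section NonUnital.
Variables (K : fieldType) (A : nuAlgType K).
Implicit Types x y z : A.

Lemma numul0r x : 0 ** x = 0.
Proof. by have := numulZl 0 (0 : A) x; rewrite !scale0r. Qed.

Lemma numulr0 x : x ** 0 = 0.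
Proof. by have := numulZr 0 x (0 : A); rewrite !scale0r. Qed.

Lemma numulNr x y : (- x) ** y = - (x ** y).
Proof. by rewrite -scaleN1r numulZl scaleN1r. Qed.

Lemma numulrN x y : x ** (- y) = - (x ** y).
Proof. by rewrite -scaleN1r numulZr scaleN1r. Qed.

Lemma numulBl x y z : (x - y) ** z = x ** z - y ** z.
Proof. by rewrite numulDl numulNr. Qed.

Lemma numul_suml (I : Type) (r : seq I) (Q : pred I) (F : I -> A) x :
  (\sum_(i <- r | Q i) F i) ** x = \sum_(i <- r | Q i) (F i ** x).
Proof.
by apply: (big_morph (fun y => y ** x)) => [y z|]; rewrite ?numulDl ?numul0r.
Qed.

Lemma numul_sumr (I : Type) (r : seq I) (Q : pred I) (F : I -> A) x :
  x ** (\sum_(i <- r | Q i) F i) = \sum_(i <- r | Q i) (x ** F i).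
Proof. by apply: (big_morph (numul x)) => [y z|]; rewrite ?numulDr ?numulr0. Qed.

Lemma subspace_sum (I : set A) (J : Type) (r : seq J) (Q : pred J) (F : J -> A) :
  subspace_set I -> (forall j, I (F j)) -> I (\sum_(j <- r | Q j) F j).
Proof. by case=> I0 ID _ IF; elim/big_ind: _. Qed.

Lemma subspaceB (I : set A) x y : subspace_set I -> I x -> I y -> I (x - y).
Proof. by case=> _ ID IZ Ix Iy; apply: ID => //; rewrite -scaleN1r; apply: IZ. Qed.

End NonUnital.

(** * Multiplication by paths and ghost paths *)

Section Paths.
Variables (G : ultragraph) (K : fieldType) (A : nuAlgType K).
Variables (P : set (vertex G) -> A) (S T : edge G -> A).

(** Paths act as operators, since without a unit the empty path is no element of the algebra. *)
Definition path_mul (a : seq (edge G)) (x : A) : A :=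
  foldr (fun e y => S e ** y) x a.
(** The first edge of [a] acts first, so this is left multiplication by the ghost of the whole
    path. *)
Definition ghost_mul (a : seq (edge G)) (x : A) : A :=
  foldl (fun y e => T e ** y) x a.

Definition edge_rel : rel (edge G) := fun e f => `[< rng e (src f) >].

Lemma path_mul_cat a b x : path_mul (a ++ b) x = path_mul a (path_mul b x).
Proof. exact: foldr_cat. Qed.

Lemma path_mulA a x y : path_mul a x ** y = path_mul a (x ** y).
Proof. by elim: a => //= e a <-; rewrite numulA. Qed.

Lemma path_mul0 a : path_mul a 0 = 0.
Proof. by elim: a => //= e a ->; rewrite numulr0. Qed.

Lemma path_mulD a x y : path_mul a (x + y) = path_mul a x + path_mul a y.
Proof. by elim: a => //= e a ->; rewrite numulDr. Qed.

Lemma path_mulN a x : path_mul a (- x) = - path_mul a x.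
Proof. by elim: a => //= e a ->; rewrite numulrN. Qed.

Lemma ghost_mul0 a : ghost_mul a 0 = 0.
Proof. by elim: a => //= e a IHa; rewrite numulr0. Qed.

Lemma ghost_mulD a x y : ghost_mul a (x + y) = ghost_mul a x + ghost_mul a y.
Proof. by elim: a x y => //= e a IHa x y; rewrite numulDr. Qed.

Lemma ghost_mulZ a k x : ghost_mul a (k *: x) = k *: ghost_mul a x.
Proof. by elim: a x => //= e a IHa x; rewrite numulZr. Qed.

Lemma ghost_mul_sum a (I : Type) (r : seq I) (Q : pred I) (F : I -> A) :
  ghost_mul a (\sum_(i <- r | Q i) F i) = \sum_(i <- r | Q i) ghost_mul a (F i).
Proof.
by apply: (big_morph (ghost_mul a)) => [y z|]; rewrite ?ghost_mulD ?ghost_mul0.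
Qed.

Lemma ideal_ghost_mul (I : set A) a x :
  two_sided_ideal I -> I x -> I (ghost_mul a x).
Proof.
by move=> [_ II]; elim: a x => //= e a IHa x Ix; apply: IHa; case: (II (T e) x Ix).
Qed.

Hypothesis fam : leavitt_family P S T.
Implicit Types (B C : set (vertex G)) (e f : edge G).

Lemma fam_P0 : P set0 = 0.
Proof. by case: fam => -[]. Qed.

Lemma fam_PI B C : gen_vertices B -> gen_vertices C -> P B ** P C = P (B `&` C).
Proof. by case: fam => -[_ PI _] _ _ _ gB gC; rewrite PI. Qed.

Lemma fam_PU B C : gen_vertices B -> gen_vertices C ->
  P (B `|` C) = P B + P C - P (B `&` C).
Proof. by case: fam => -[_ _ PU] _ _ _; apply: PU. Qed.

Lemma fam_PS e : P [set src e] ** S e = S e.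
Proof. by case: fam => _ /(_ e)[]. Qed.

Lemma fam_SP e : S e ** P (rng e) = S e.
Proof. by case: fam => _ /(_ e)[]. Qed.

Lemma fam_PT e : P (rng e) ** T e = T e.
Proof. by case: fam => _ /(_ e)[]. Qed.

Lemma fam_TP e : T e ** P [set src e] = T e.
Proof. by case: fam => _ /(_ e)[]. Qed.

Lemma fam_TS e f : T e ** S f = if e == f then P (rng e) else 0.
Proof. by case: fam. Qed.

Lemma fam_split B C : gen_vertices B -> gen_vertices C ->
  P B = P (B `&` C) + P (B `\` C).
Proof.
move=> gB gC; rewrite -{1}[B](setUIDK B C) fam_PU //; last 2 first.
- exact: gen_verticesI.
- exact: gen_verticesD.
rewrite (_ : B `&` C `&` (B `\` C) = set0) ?fam_P0 ?subr0 //.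
by apply/seteqP; split=> // v [[_ Cv] [_]].
Qed.

Lemma set1I (v : vertex G) B : [set v] `&` B = if `[< B v >] then [set v] else set0.
Proof.
case: asboolP => Bv; apply/seteqP; split=> w //=; first by case.
- by move=> ->.
- by case=> -> /Bv.
Qed.

Lemma fam_PSE B e : gen_vertices B -> P B ** S e = if `[< B (src e) >] then S e else 0.
Proof.
move=> gB; rewrite -[in LHS]fam_PS numulA fam_PI //; last exact: gen_vertices1.
rewrite setIC set1I; case: ifP => _; first by rewrite fam_PS.
by rewrite fam_P0 numul0r.
Qed.

Lemma fam_TPE B e : gen_vertices B -> T e ** P B = if `[< B (src e) >] then T e else 0.
Proof.
move=> gB; rewrite -[in LHS]fam_TP -numulA fam_PI //; last exact: gen_vertices1.
rewrite set1I; case: ifP => _; first by rewrite fam_TP.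
by rewrite fam_P0 numulr0.
Qed.

Lemma fam_P1E (v : vertex G) B : gen_vertices B ->
  P B ** P [set v] = if `[< B v >] then P [set v] else 0.
Proof.
move=> gB; rewrite fam_PI //; last exact: gen_vertices1.
by rewrite setIC set1I; case: ifP; rewrite ?fam_P0.
Qed.

Lemma ghost_path_mul e a x :
  ghost_mul (e :: a) (path_mul (e :: a) x)
  = if path edge_rel e a then P (rng (last e a)) ** x else 0.
Proof.
elim: a e x => [|f a IHa] e x /=; first by rewrite numulA fam_TS eqxx.
rewrite [T e ** _]numulA fam_TS eqxx [P _ ** _]numulA fam_PSE;
  last exact: gen_verticesr.
rewrite {1}/edge_rel; case: ifP => _ /=; first exact: IHa.
by rewrite numul0r numulr0 ghost_mul0.
Qed.

(** Equal leading edges cancel to a range projection; at the first place where the lists differ,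
    [T e ** S f] vanishes. *)
Lemma ghost_path_mul_neq a b x : (size a <= size b)%N -> take (size a) b != a ->
  ghost_mul a (path_mul b x) = 0.
Proof.
elim: a b x => [|e a IHa] [|f b] x //=.
rewrite ltnS eqseq_cons numulA fam_TS => ab.
case: eqVneq => [_|_] /=; last by rewrite numul0r ghost_mul0.
move=> ne.
(* The leftover projection fixes or kills the next edge. Writing zero as a path applied to 0 keeps
   the shape that the induction needs. *)
have Pz : exists z, P (rng e) ** path_mul b x = path_mul b z.
  case: b {IHa ab ne} => [|f' b] /=; first by eexists.
  rewrite numulA fam_PSE; last exact: gen_verticesr.
  case: ifP => _; first by exists x.
  by exists 0; rewrite path_mul0 numulr0 numul0r.
by have [z ->] := Pz; apply: IHa.
Qed.

(** If [f] does not start in the range of [e], then [P (rng e)] between [S e] and [S f] kills the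
    product. Hence arbitrary lists of edges may be used as paths. *)
Lemma path_mul_proper e a x :
  path_mul (e :: a) x
  = if path edge_rel e a then path_mul (e :: a) (P (rng (last e a)) ** x) else 0.
Proof.
elim: a e x => [|f a IHa] e x; first by rewrite /= numulA fam_SP.
have -> : path_mul [:: e, f & a] x = S e ** (P (rng e) ** (S f ** path_mul a x)).
  by rewrite numulA fam_SP.
rewrite [P _ ** _]numulA fam_PSE; last exact: gen_verticesr.
rewrite [path _ _ _]/= {1}/edge_rel; case: ifP => _; last by rewrite numul0r numulr0.
have /= -> := IHa f x; case: ifP => //= _; rewrite ?numulr0 //.
Qed.

End Paths.

Lemma seq_argmin (X : Type) (m : X -> nat) (s : seq X) : (0 < size s)%N ->
  exists s1 u s2, s = s1 ++ u :: s2 /\ all (fun v => m u <= m v)%N s.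
Proof.
elim: s => [//|a [_ _|b s /(_ isT) [s1 [u [s2 [-> mu]]]] _]].
  by exists [::], a, [::]; rewrite /= leqnn.
have [au|ua] := leqP (m a) (m u).
  exists [::], a, (s1 ++ u :: s2); split=> //=; rewrite leqnn /=.
  by apply: sub_all mu => v; apply: leq_trans.
by exists (a :: s1), u, s2; split=> //=; rewrite (ltnW ua) mu.
Qed.

Lemma has_decomp (X : Type) (a : pred X) (s : seq X) : has a s ->
  exists s1 u s2, s = s1 ++ u :: s2 /\ a u.
Proof.
elim: s => //= x s IHs; case ax: (a x) => /=; first by exists [::], x, s.
by move=> /IHs[s1 [u [s2 [-> au]]]]; exists (x :: s1), u, s2.
Qed.

(** * Elements of an ideal without ghost edges *)

Section RealElements.
Variables (G : ultragraph) (K : fieldType) (L : nuAlgType K).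
Variables (P : set (vertex G) -> L) (S T : edge G -> L).
Hypothesis fam : leavitt_family P S T.

Definition gset := {B : set (vertex G) | gen_vertices B}.
Definition gsetI (B C : gset) : gset :=
  exist _ (sval B `&` sval C) (gen_verticesI (svalP B) (svalP C)).
Definition gsetD (B C : gset) : gset :=
  exist _ (sval B `\` sval C) (gen_verticesD (svalP B) (svalP C)).

Definition term : Type := K * seq (edge G) * gset.
Definition term_val (u : term) : L := u.1.1 *: path_mul S u.1.2 (P (sval u.2)).
Definition lin (l : seq term) : L := \sum_(u <- l) term_val u.

Definition real_elt (x : L) : Prop := exists l, x = lin l.

Lemma lin_cons u l : lin (u :: l) = term_val u + lin l.
Proof. exact: big_cons. Qed.

Lemma lin_cat l1 l2 : lin (l1 ++ l2) = lin l1 + lin l2.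
Proof. exact: big_cat. Qed.

Lemma lin_move l1 u l2 : lin (l1 ++ u :: l2) = lin (u :: l1 ++ l2).
Proof. by rewrite !(lin_cat, lin_cons) addrCA. Qed.

Definition termsI (B : gset) (l : seq term) := [seq (u.1, gsetI u.2 B) | u <- l].
Definition termsD (B : gset) (l : seq term) := [seq (u.1, gsetD u.2 B) | u <- l].

Lemma lin_mulP l (B : gset) : lin l ** P (sval B) = lin (termsI B l).
Proof.
rewrite numul_suml /lin big_map; apply: eq_bigr => u _.
by rewrite /term_val /= numulZl path_mulA (fam_PI fam) //; apply: svalP.
Qed.

Lemma lin_subP l (B : gset) : lin l - lin l ** P (sval B) = lin (termsD B l).
Proof.
rewrite lin_mulP /lin !big_map -sumrB; apply: eq_bigr => u _.
rewrite /term_val /= -scalerBr -path_mulN -path_mulD; congr (_ *: path_mul _ _ _).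
by rewrite (fam_split fam (svalP u.2) (svalP B)) addrC addKr.
Qed.

Lemma termsD_size B l : size (termsD B l) = size l.
Proof. exact: size_map. Qed.

Lemma termsI_size B l : size (termsI B l) = size l.
Proof. exact: size_map. Qed.

Variable I : set L.
Hypothesis idI : two_sided_ideal I.

(** The length is minimized over all nonzero real elements of [I], not only over the representations
    of [w]; then a term with shortest path is moved to the front. *)
Lemma shortest_lin w : I w -> w <> 0 -> real_elt w ->
  exists (u : term) (l : seq term),
    [/\ I (lin (u :: l)), lin (u :: l) <> 0,
        all (fun v : term => size u.1.2 <= size v.1.2)%N l
      & forall l', (size l' <= size l)%N -> I (lin l') -> lin l' = 0].
Proof.
move=> Iw wn0 [lw wE].
pose Q n := `[< exists l, [/\ size l = n, I (lin l) & lin l <> 0] >].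
have exQ : exists n, Q n.
  by exists (size lw); apply/asboolP; exists lw; rewrite -wE.
have [n /asboolP[l [ln Il ln0]] nmin] := ex_minnP exQ.
have l_gt0 : (0 < size l)%N.
  by rewrite lt0n; apply/negP => /nilP l0; apply: ln0; rewrite l0 /lin big_nil.
have [s1 [u [s2 [lE lmin]]]] := seq_argmin (fun v : term => size v.1.2) l_gt0.
exists u, (s1 ++ s2); rewrite -lin_move -lE; split=> //.
  by move: lmin; rewrite {1}lE !all_cat /= => /and3P[-> _ ->].
move=> l' l's Il'; apply: contrapT => l'n0.
have /nmin : Q (size l') by apply/asboolP; exists l'.
rewrite -ln lE size_cat /= addnS ltnNge => /negP[].
by rewrite size_cat in l's.
Qed.

(* With a representation of minimal length, no two terms share their path:
   cutting with the range of one of them would shorten the representation. *)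
Lemma ideal_unitriangular w : I w -> w <> 0 -> real_elt w ->
  exists (B : gset) (l : seq term),
    [/\ sval B !=set0, all (fun u : term => u.1.2 != [::]) l
      & I (P (sval B) + lin l)].
Proof.
move=> Iw wn0 wR; have [subI mulI] := idI.
have [[[k a] B] [l [Ix xn0 la lmin]]] := shortest_lin Iw wn0 wR.
set x := lin _ in Ix xn0; rewrite /= in la.
have xB (C : gset) : I (x ** P (sval C)) by case: (mulI (P (sval C)) x Ix).
(* Otherwise [x] equals [x - x ** P (sval B)], where the first term cancels and a shorter sum
   remains. *)
have xBn0 : x ** P (sval B) <> 0.
  move=> xB0; apply: xn0.
  have xE : x = lin (termsD B l).
    rewrite -lin_subP -[LHS]subr0 -xB0 /x lin_cons numulDl.
    suff -> : term_val (k, a, B) ** P (sval B) = term_val (k, a, B).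
      by rewrite opprD addrACA subrr add0r.
    rewrite /term_val /= numulZl path_mulA (fam_PI fam) ?setIid //.
      exact: svalP.
    exact: svalP.
  by rewrite xE; apply: lmin; rewrite ?termsD_size // -xE.
(* Suppose a second term has path [a] and set [B']. Cutting [x] with the intersection of [B] and
   [B'] merges the two terms, and cutting with the difference kills the second. Both results are
   shorter, hence zero, so [x ** P (sval B)] is zero. *)
have nhas : ~~ has (fun u : term => u.1.2 == a) l.
  apply/negP => /has_decomp[s1 [[[k' a'] B'] [s2 [lE /= /eqP a'E]]]].
  rewrite {}a'E in lE.
  have xE : x = lin [:: (k, a, B), (k', a, B') & s1 ++ s2].
    by rewrite /x lE lin_cons lin_move lin_cons !lin_cons.
  have s12 : size l = (size (s1 ++ s2)).+1 by rewrite lE !size_cat /= addnS.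
  have xBB0 : x ** P (sval (gsetI B B')) = 0.
    have e : x ** P (sval (gsetI B B'))
        = lin ((k + k', a, gsetI B B') :: termsI (gsetI B B') (s1 ++ s2)).
      rewrite xE lin_mulP /termsI !map_cons /= !lin_cons addrA; congr (_ + _).
      by rewrite /term_val /= setIA setIid setICA setIid -scalerDl.
    by rewrite e; apply: lmin; rewrite ?s12 /= ?termsI_size // -e.
  have xBD0 : x ** P (sval (gsetD B B')) = 0.
    have e : x ** P (sval (gsetD B B'))
        = lin ((k, a, gsetD B B') :: termsI (gsetD B B') (s1 ++ s2)).
      rewrite xE lin_mulP /termsI !map_cons /= !lin_cons; congr (_ + _).
        by rewrite /term_val /= setIDA setIid.
      rewrite /term_val /= (_ : _ `&` _ = set0).
        by rewrite (fam_P0 fam) path_mul0 scaler0 add0r.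
      by apply/seteqP; split=> // v [B'v [_]].
    by rewrite e; apply: lmin; rewrite ?s12 /= ?termsI_size // -e.
  apply: xBn0; rewrite (fam_split fam (svalP B) (svalP B')) numulDr.
  by rewrite [X in X + _]xBB0 [X in _ + X]xBD0 addr0.
have aB0 : path_mul S a (P (sval B)) <> 0.
  move=> aB0; apply: xn0.
  have e : x = lin l by rewrite /x lin_cons /term_val aB0 scaler0 add0r.
  by rewrite e; apply: lmin; rewrite // -e.
have k0 : k != 0.
  apply/eqP => k0; apply: xn0.
  have e : x = lin l by rewrite /x lin_cons /term_val k0 scale0r add0r.
  by rewrite e; apply: lmin; rewrite // -e.
have [B' [B'0 TB']] : exists B' : gset, sval B' !=set0 /\
    ghost_mul T a (path_mul S a (P (sval B))) = P (sval B').
  case: a aB0 {la nhas xBn0 xB x Ix xn0 lmin} => [|e a] aB0.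
    exists B; split=> //; apply: contrapT => /nonemptyPn B0; apply: aB0.
    by rewrite /= B0 (fam_P0 fam).
  rewrite (ghost_path_mul fam); rewrite (path_mul_proper fam) in aB0.
  case: ifP aB0 => // _; set r := rng _; pose R : gset := exist _ r (gen_verticesr _).
  rewrite (fam_PI fam); [|exact: svalP R|exact: svalP].
  move=> aB0; exists (gsetI R B); split=> //; apply: contrapT => /nonemptyPn B0.
  by apply: aB0; rewrite [r `&` _]B0 (fam_P0 fam) path_mul0.
(* The other paths are no shorter than [a] and different from it. Those that begin with [a] keep a
   nonempty remainder, and the rest are killed. *)
have tl (l' : seq term) : all (fun v : term => size a <= size v.1.2)%N l' ->
    ~~ has (fun u : term => u.1.2 == a) l' ->
    exists2 l'', all (fun u : term => u.1.2 != [::]) l''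
      & ghost_mul T a (lin l') = lin l''.
  elim: l' => [|[[k' b] C] l' IHl' /=].
    by exists [::]; rewrite // /lin !big_nil ghost_mul0.
  rewrite negb_or => /andP[ab al'] /andP[ba /(IHl' al') [l'' l''n l''E]].
  rewrite lin_cons ghost_mulD l''E /term_val /= ghost_mulZ.
  have [tb|tb] := eqVneq (take (size a) b) a; last first.
    by rewrite (ghost_path_mul_neq fam) // scaler0 add0r; exists l''.
  have := cat_take_drop (size a) b; rewrite tb => bE.
  have d0 : drop (size a) b != [::].
    by apply: contra ba => /eqP d0; rewrite -bE d0 cats0.
  move: (drop _ _) bE d0 => d <- d0.
  rewrite path_mul_cat.
  case: a {ab ba tb aB0 la nhas TB' x Ix xn0 xB xBn0 lmin IHl' l''E al'}
      => [|e a].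
    by exists ((k', d, C) :: l''); rewrite /= ?d0 ?lin_cons.
  rewrite (ghost_path_mul fam); case: ifP => _; last first.
    by rewrite scaler0 add0r; exists l''.
  case: d d0 => // f d _; rewrite /= numulA (fam_PSE fam); last exact: gen_verticesr.
  case: ifP => _; last by rewrite numul0r scaler0 add0r; exists l''.
  by exists ((k', f :: d, C) :: l''); rewrite //= lin_cons.
have [l' l'n l'E] := tl l la nhas.
have := ideal_ghost_mul T a idI Ix.
rewrite {1}/x lin_cons ghost_mulD l'E /term_val /= ghost_mulZ TB' => Ik.
exists B', [seq ((k^-1 * u.1.1, u.1.2), u.2) | u <- l']; split=> //.
  by rewrite all_map.
case: subI => _ _ /(_ k^-1 _ Ik); rewrite scalerDr scalerA mulVf // scale1r.
congr (I (_ + _)); rewrite /lin big_map scaler_sumr; apply: eq_bigr => u _.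
by rewrite /term_val /= scalerA.
Qed.

Definition closed_at (v : vertex G) (a : seq (edge G)) : bool :=
  if a is e :: a' then
    [&& src e == v, path (@edge_rel G) e a' & `[< rng (last e a') v >]]
  else false.

Lemma closed_path_mul v a B : a != [::] -> gen_vertices B ->
  P [set v] ** path_mul S a (P B) ** P [set v]
  = if closed_at v a && `[< B v >] then path_mul S a (P [set v]) else 0.
Proof.
case: a => // e a _ gB; have g1 := gen_vertices1 v.
rewrite -numulA path_mulA (fam_P1E fam) //.
case: (asboolP (B v)) => _; last by rewrite path_mul0 numulr0 andbF.
rewrite andbT {1}[path_mul]lock /= -lock.
have -> : P [set v] ** path_mul S (e :: a) (P [set v])
    = if src e == v then path_mul S (e :: a) (P [set v]) else 0.
  rewrite /= numulA (fam_PSE fam) //=; case: asboolP => [->|]; first by rewrite eqxx.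
  by move/eqP/negbTE => ->; rewrite numul0r.
case: eqP => _ //; rewrite {1}(path_mul_proper fam) andTb; case: ifP => _ //.
rewrite andTb (fam_P1E fam); last exact: gen_verticesr.
by case: ifP; rewrite ?path_mul0.
Qed.

(** Multiplying by [P [set v]] on both sides, for some [v] in the leading set, leaves only the paths
    closed at [v]. *)
Lemma ideal_vertex_unitriangular w : I w -> w <> 0 -> real_elt w ->
  exists (v : vertex G) (l : seq (K * seq (edge G))),
    all (fun u => closed_at v u.2) l
    /\ I (P [set v] + \sum_(u <- l) u.1 *: path_mul S u.2 (P [set v])).
Proof.
move=> Iw wn0 wR; have [B [l [[v Bv] ln IB]]] := ideal_unitriangular Iw wn0 wR.
have [_ mulI] := idI; have g1 := gen_vertices1 v.
have [IB1 _] := mulI (P [set v]) _ IB; have [_ {IB1}] := mulI (P [set v]) _ IB1.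
rewrite numulDr numulDl (fam_PI fam) //; last exact: svalP.
rewrite set1I asboolT // (fam_PI fam) // setIid => Iv.
pose good (u : term) := closed_at v u.1.2 && `[< sval u.2 v >].
exists v, [seq u.1 | u <- l & good u]; split.
  rewrite all_map; have := filter_all good l.
  by apply: sub_all => u /andP[].
move: Iv; rewrite numul_sumr numul_suml big_map big_filter [in X in _ -> X]big_mkcond /=.
suff -> : \sum_(u <- l) P [set v] ** term_val u ** P [set v]
  = \sum_(u <- l) (if good u then u.1.1 *: path_mul S u.1.2 (P [set v]) else 0) by [].
elim: l ln {IB} => [|u l IHl /= /andP[un /IHl {}IHl]]; first by rewrite !big_nil.
rewrite !big_cons IHl /good; congr (_ + _).
rewrite numulZr numulZl closed_path_mul //; last exact: svalP.
by case: ifP; rewrite ?scaler0.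
Qed.

End RealElements.

(** * Walks as lists, and periodic sequences *)

Section Walks.
Variable G : ultragraph.

Lemma path_walk (f : nat -> edge G) m :
  (forall k, (k < m)%N -> rng (f k) (src (f k.+1))) ->
  path (@edge_rel G) (f 0%N) (mkseq (f \o succn) m)
  /\ last (f 0%N) (mkseq (f \o succn) m) = f m.
Proof.
elim: m => [//|m IHm] fm.
have [pm lm] : path (@edge_rel G) (f 0%N) (mkseq (f \o succn) m)
  /\ last (f 0%N) (mkseq (f \o succn) m) = f m.
  by apply: IHm => k km; apply: fm; rewrite ltnS ltnW.
rewrite /mkseq -addn1 iotaD map_cat cats1 rcons_path last_rcons addn1.
by split=> //; rewrite -/(mkseq _ _) pm lm; apply/asboolP/fm.
Qed.

Lemma closed_at_cycle (v : vertex G) e a : closed_at v (e :: a) ->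
  is_cycle (fun i : 'I_(size a).+1 => nth e (e :: a) i).
Proof.
move=> /and3P[/eqP ev pa /asboolP la] i.
have iS := ltn_ord i; rewrite ltnS leq_eqVlt in iS.
have [im|im] := orP iS.
  rewrite [ordS i](_ : _ = ord0); last first.
    by apply: val_inj; rewrite /= (eqP im) modnn.
  by rewrite /= ev (eqP im) -last_nth.
rewrite [nat_of_ord (ordS i)](_ : _ = i.+1); last by rewrite /= modn_small.
by have /(pathP e) /(_ i im) /asboolP := pa.
Qed.

(** The shifts by [p] and [q] commute: f(m) = c(m - q) = c(m - q - p) = f(m - p) = c(m). *)
Lemma two_periods (X : Type) (f c : nat -> X) m p q : (p + q <= m)%N ->
  (0 < p)%N -> (0 < q)%N ->
  (forall k, (k < m)%N -> f k = c k) -> (forall k, c (k + p) = c k) ->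
  (forall k, (q <= k <= m)%N -> f k = f (k - q)%N) -> f m = c m.
Proof.
move=> pqm p0 q0 fc cp fq.
have c_sub k : (p <= k)%N -> c (k - p)%N = c k by move=> pk; rewrite -{2}(subnK pk) cp.
have e1 : f m = c (m - q - p)%N by rewrite fq ?fc ?c_sub //; lia.
have e2 : f (m - p)%N = c (m - p - q)%N by rewrite fq ?fc //; lia.
have e3 : f (m - p)%N = c m by rewrite fc ?c_sub //; lia.
by rewrite e1 -e3 e2; congr c; lia.
Qed.

End Walks.

(** * Projections in an ideal under Condition (L) *)

Section Uniqueness.
Variables (G : ultragraph) (K : fieldType) (L : nuAlgType K).
Variables (P : set (vertex G) -> L) (S T : edge G -> L).
Hypothesis fam : leavitt_family P S T.
Variable I : set L.
Hypothesis idI : two_sided_ideal I.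

(** Multiplying by the path [d :: a] on the right and by its ghost on the left turns [P [set v]]
    into the projection of the last range, which is then cut down to [B]. *)
Lemma ideal_compress v (l : seq (K * seq (edge G))) d a B :
    I (P [set v] + \sum_(u <- l) u.1 *: path_mul S u.2 (P [set v])) ->
    src d = v -> path (@edge_rel G) d a -> gen_vertices B ->
    B `<=` rng (last d a) ->
    (forall u, u \in l ->
      P B ** ghost_mul T (d :: a) (path_mul S (u.2 ++ d :: a) (P B)) = 0) ->
  I (P B).
Proof.
move=> Iw dv da gB Bd lB; have [_ mulI] := idI.
have [_] := mulI (path_mul S (d :: a) (P B)) _ Iw.
move=> /(ideal_ghost_mul T (d :: a) idI) /(mulI (P B)) [+ _].
have PS : P [set v] ** path_mul S (d :: a) (P B) = path_mul S (d :: a) (P B).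
  by rewrite /= numulA -dv (fam_PS fam).
rewrite numulDl ghost_mulD numulDr PS numul_suml ghost_mul_sum numul_sumr.
rewrite (ghost_path_mul fam) da (fam_PI fam) //; last exact: gen_verticesr.
rewrite setIidr // (fam_PI fam) // setIid big1_seq ?addr0 // => u /andP[_ /lB].
rewrite numulZl ghost_mulZ numulZr path_mulA PS -path_mul_cat => ->.
by rewrite scaler0.
Qed.

Lemma conditionL_ideal_vertices w : conditionL G -> I w -> w <> 0 ->
  real_elt P S w -> exists B, [/\ gen_vertices B, B !=set0 & I (P B)].
Proof.
move=> condL Iw wn0 wR.
have [v [l [lv Iv]]] := ideal_vertex_unitriangular fam idI Iw wn0 wR.
case: l lv Iv => [|[k0 [//|e0 a0]] l] lv Iv.
  exists [set v]; split; [exact: gen_vertices1|by exists v|].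
  by move: Iv; rewrite big_nil addr0.
set l0 := (k0, e0 :: a0) :: l in lv Iv.
have /andP[/= e0v _] := lv; rewrite -/(closed_at v (e0 :: a0)) in e0v.
have cyc := closed_at_cycle e0v.
have {}e0v : src e0 = v by case/and3P: e0v => /eqP.
set n := size a0 in cyc; pose a (i : 'I_n.+1) := nth e0 (e0 :: a0) i.
(* The infinite walk around the cycle given by the first closed path. *)
pose c k := a (inord (k %% n.+1)).
have cS k : c k.+1 = a (ordS (inord (k %% n.+1))).
  rewrite /c; congr a; apply: val_inj; rewrite /= !inordK ?ltn_mod //.
  by rewrite -addn1 -(modnDml k) addn1.
have cp k : c (k + n.+1)%N = c k by rewrite /c modnDr.
have crel k : rng (c k) (src (c k.+1)) by rewrite cS; apply: cyc.
have c0 : c 0%N = e0 by rewrite /c mod0n /a inordK.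
(* A common bound for the lengths of all the closed paths. *)
pose N := (\sum_(u <- l0) size u.2)%N.
have szN u : u \in l0 -> (size u.2 <= N)%N.
  by move=> ul; rewrite /N (big_rem u) //= leq_addr.
have ci (i : 'I_n.+1) : c (N.+1 * n.+1 + i)%N = a i.
  rewrite /c; congr a; apply: val_inj.
  by rewrite /= modnMDl modn_small // inord_val.
have szu u : u \in l0 -> (0 < size u.2)%N.
  by move=> /(allP lv); case: u.2.
have [[e [i [ie ne]]]|[i [w' [iw sw]]]] := condL n a cyc.
  (* The walk makes [N.+1] full turns, goes on to [a i] and leaves by the exit [e] at place [m]. So
     many turns make [m] at least the cycle length plus the length of any closed path in the sum. *)
  pose m := (N.+1 * n.+1 + i).+1.
  pose f k := if (k < m)%N then c k else e.
  have fm : f m = e by rewrite /f ltnn.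
  have f0 : f 0%N = e0 by rewrite /f.
  have [|pf lf] := @path_walk G f m.
    move=> k km; rewrite /f km; case: ltnP => // mk.
    have -> : k = (N.+1 * n.+1 + i)%N by apply/eqP; rewrite eqn_leq -ltnS km -ltnS.
    by rewrite ci.
  exists (rng e); split; [exact: gen_verticesr|exact: rng_neq0|].
  apply: (ideal_compress Iv _ pf); rewrite ?lf ?fm //.
  - by rewrite f0.
  - exact: gen_verticesr.
  move=> u ul; rewrite (ghost_path_mul_neq fam) ?numulr0 //.
    by rewrite size_cat leq_addl.
  (* A walk that is a prefix of [u.2] followed by itself has period [size u.2]. Since it follows the
     cycle before [m], its last edge would follow the cycle too, and [e] would be no exit. *)
  apply/eqP => tk; case: ne; rewrite -fm.
  have -> : a (ordS i) = c m.
    rewrite /m cS; congr (a (ordS _)); apply: val_inj.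
    by rewrite /= modnMDl modn_small // inord_val.
  have un := szN u ul.
  apply: (@two_periods _ f c m n.+1 (size u.2)) => //; [|exact: szu| |].
  - by rewrite /m; nia.
  - by move=> k km; rewrite /f km.
  have fE k : (k <= m)%N -> f k = nth e0 (f 0%N :: mkseq (f \o succn) m) k.
    by case: k => // k km; rewrite /= nth_mkseq.
  move=> k /andP[uk km]; rewrite fE // -tk nth_take; last first.
    by rewrite /= size_map size_iota ltnS.
  by rewrite nth_cat ltnNge uk /= -fE //; lia.
(* In the other case the walk stops at [a i], whose range contains the sink [w']. *)
have [|pc lc] := @path_walk G c (N.+1 * n.+1 + i) _; first by move=> k _.
exists [set w']; split; [exact: gen_vertices1|by exists w'|].
apply: (ideal_compress Iv _ pc); rewrite ?lc ?ci //.
- by rewrite c0.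
- exact: gen_vertices1.
- by move=> _ ->.
move=> u ul; set s := mkseq _ _ in pc lc *.
have [tk|tk] :=
  eqVneq (take (size (c 0%N :: s)) (u.2 ++ c 0%N :: s)) (c 0%N :: s); last first.
  by rewrite (ghost_path_mul_neq fam) ?numulr0 // size_cat leq_addl.
rewrite -[u.2 ++ _](cat_take_drop (size (c 0%N :: s))) tk.
(* What remains after cancelling the walk is a nonempty list of edges, and its first edge is killed
   by the projection at a sink. *)
have : (0 < size (drop (size (c 0%N :: s)) (u.2 ++ c 0%N :: s)))%N.
  by rewrite size_drop size_cat addnK; apply: szu.
case: (drop _ _) => // e d _; rewrite path_mul_cat (ghost_path_mul fam) pc.
rewrite numulA (fam_PI fam) //; [|exact: gen_vertices1|exact: gen_verticesr].
rewrite /= numulA (fam_PSE fam); last first.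
  by apply: gen_verticesI; [exact: gen_vertices1|exact: gen_verticesr].
case: asboolP => [[/= ew _]|_]; last by rewrite numul0r.
by have : out_edges w' e by []; rewrite sw.
Qed.

End Uniqueness.

(** * Linear independence of paths *)

Lemma morph_path_mul (G : ultragraph) (K : fieldType) (A B : nuAlgType K)
    (f : A -> B) (S : edge G -> A) (S' : edge G -> B) a x :
    multiplicative_map f -> (forall e, f (S e) = S' e) ->
  f (path_mul S a x) = path_mul S' a (f x).
Proof. by move=> fM fS; elim: a => //= e a IHa; rewrite fM IHa fS. Qed.

(** The condition for [a] to be continued by an edge with source [v]; the empty list always can
    be. *)
Definition path_to (G : ultragraph) (a : seq (edge G)) (v : vertex G) : bool :=
  if a is e :: a' then path (@edge_rel G) e a' && `[< rng (last e a') v >]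
  else true.

Section Degree.
Variables (G : ultragraph) (H : set (set (vertex G))) (K : fieldType).
Hypothesis hH : hereditary H.

Notation S1 := (@pointS G H K 1).

Definition point_path (a : seq (edge G)) (z : point G) : point G :=
  foldr (point_cons 1) z a.

Lemma boundary_point_path a z e : boundary H z.1 -> base (z.1 0%N) (rng e) ->
  path_to a (src e) -> boundary H (point_path a (point_cons 1 e z)).1.
Proof.
move=> bz ze; case: a => [_|f a]; first exact: boundary_cons.
elim: a f => [|f' a IHa] f /=.
  by move=> /asboolP fe; apply: boundary_cons => //; apply: boundary_cons.
move=> /andP[/andP[/asboolP ff' pa] la].
apply: boundary_cons => //.
by apply: IHa; rewrite /path_to pa.
Qed.

Lemma point_path_degree a z : (point_path a z).2 = z.2 + (size a)%:R.
Proof.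
elim: a => [|e a IHa] /=; first by rewrite addr0.
by rewrite IHa -addrA natr1.
Qed.

Variables (z : point G) (e : edge G).
Hypotheses (bz : boundary H z.1) (ze : base (z.1 0%N) (rng e)).

Let delta (y : point G) : K := if `[< y = z >] then 1 else 0.

(** Each factor raises the degree by one, so the image of [delta] lives in a single degree. *)
Lemma path_mul_delta_degree a y : y.2 != z.2 + (size a).+1%:R ->
  path_mul S1 a (S1 e) delta y = 0.
Proof.
elim: a y => [|f a IHa] [x k] /= ky.
  case: asboolP => // _; rewrite /delta /point_tail /=; case: asboolP => // xz.
  by case/eqP: ky; rewrite -xz /= subrK.
case: asboolP => // _; rewrite IHa //=.
by apply: contra ky => /eqP; rewrite -[_.+2%:R]natr1 addrA => <-; rewrite subrK.
Qed.

(** The lists are compared edge by edge. If one ends first, the degrees differ; this is what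
    separates paths that wind around the same periodic boundary path. *)
Lemma path_mul_delta a b :
  path_to b (src e) ->
  path_mul S1 a (S1 e) delta (point_path b (point_cons 1 e z)) = (a == b)%:R.
Proof.
have pt f y : point_tail 1 (point_cons 1 f y) = y.
  by case: y => x k; congr pair; rewrite addrK.
have Rc f g y : boundary H (point_cons 1 f y).1 ->
    `[< pointR H g (point_cons 1 f y) >] = (g == f).
  move=> bfy; apply/asboolP/eqP => [[_ [->]] //|->]; split=> //.
have R0 a' f y : y.2 = z.2 -> path_mul S1 (f :: a') (S1 e) delta (point_cons 1 e y) = 0.
  move=> yz; apply: path_mul_delta_degree; rewrite /= yz (inj_eq (addrI _)).
  by rewrite -[X in X == _]/(1%:R) Num.Theory.eqr_nat.
elim: a b => [|f a IHa] [|f' b] bP.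
- rewrite /= (Rc e e z); last exact: boundary_cons.
  by rewrite eqxx pt /delta asboolT.
- have bb := boundary_point_path bz ze bP.
  apply: path_mul_delta_degree; rewrite point_path_degree /= -addrA (inj_eq (addrI _)).
  by rewrite -[X in X + _ == _]/(1%:R) -natrD Num.Theory.eqr_nat.
- by rewrite [point_path _ _]/= R0.
- have bb := boundary_point_path bz ze bP.
  rewrite /= [X in if X then _ else _]Rc // pt eqseq_cons.
  case: eqP => //= _; apply: IHa.
  by case: b bP {bb} => // f'' b /= /andP[/andP[_ ->]].
Qed.

End Degree.

Section Independence.
Variables (G : ultragraph) (K : fieldType) (L : nuAlgType K).
Variables (p : set (vertex G) -> L) (s t : edge G -> L).
Hypothesis hL : is_leavitt_path_algebra p s t.

Let fam : leavitt_family p s t. Proof. by case: hL. Qed.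

Lemma leavitt_morphism H (d : int) : H set0 -> hereditary H -> saturated H ->
  exists f : {linear L -> endofun K (point G)},
    [/\ multiplicative_map f,
        forall B, gen_vertices B -> f (p B) = pointP H K B
      & forall e, f (s e) = pointS H K d e /\ f (t e) = pointT H K d e].
Proof.
by move=> H0 hH sH; case: hL => _ _; apply; apply: point_family.
Qed.

(** In the graded representation, the value at the point that runs through [b], then [e], then a
    fixed boundary path is the total coefficient of [b]. Lists that do not lead to [v] contribute
    zero anyway. *)
Lemma path_mul_independent (v : vertex G) e (l : seq (K * seq (edge G))) :
    src e = v ->
    \sum_(u <- l) u.1 *: path_mul s u.2 (s e) = 0 ->
  \sum_(u <- l) u.1 *: path_mul s u.2 (p [set v]) = 0.
Proof.
move=> ev l0.
have [f [fM _ fst]] := leavitt_morphism 1 (erefl _) (@hereditary1 G) (@saturated1 G).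
have fs x : f (s x) = pointS [set set0] K 1 x by case: (fst x).
have nHe : ~ [set set0] (rng e).
  by move=> /= e0; case: (rng_neq0 e) => w; rewrite e0.
have [x bx xe] := exists_boundary (erefl _) (@hereditary1 G) (@saturated1 G)
  (gen_verticesr e) nHe.
pose z : point G := (x, 0).
have coef b : path_to b (src e) -> \sum_(u <- l | u.2 == b) u.1 = 0.
  move=> bP; pose psi (y : point G) : K := if `[< y = z >] then 1 else 0.
  have f0 : f (\sum_(u <- l) u.1 *: path_mul s u.2 (s e)) psi
      (point_path b (point_cons 1 e z)) = 0 by rewrite l0 linear0.
  rewrite -[RHS]f0 linear_sum endofun_sumE.
  rewrite big_mkcond; apply: eq_bigr => u _.
  rewrite linearZ_LR (morph_path_mul _ _ fM fs) fs /=.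
  have := path_mul_delta K (@hereditary1 G) (z := z) bx xe u.2 bP.
  move=> /= ->; case: eqP; rewrite ?mulr1 ?mulr0 //.
(* The sum is regrouped by distinct paths. *)
rewrite (eq_big_seq (fun u => \sum_(b <- undup (map snd l)) if u.2 == b then
   u.1 *: path_mul s b (p [set v]) else 0)); last first.
  move=> u ul; rewrite (bigD1_seq u.2) ?undup_uniq ?mem_undup ?map_f //= eqxx.
  by rewrite big1 ?addr0 // => b /negbTE; rewrite eq_sym => ->.
rewrite exchange_big big1 //= => b _.
rewrite -big_mkcond -scaler_suml.
case: b => [|e' b]; first by rewrite coef ?scale0r.
rewrite (path_mul_proper fam) (fam_P1E fam); last exact: gen_verticesr.
case: ifP => pb; last by rewrite scaler0.
case: asboolP => lb; last by rewrite path_mul0 scaler0.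
by rewrite coef ?scale0r // /path_to pb asboolT // ev.
Qed.

End Independence.

(** * Removing ghost edges *)

Section GhostDegree.
Variables (G : ultragraph) (K : fieldType) (L : nuAlgType K).
Variables (p : set (vertex G) -> L) (s t : edge G -> L).
Hypothesis hL : is_leavitt_path_algebra p s t.

Let fam : leavitt_family p s t. Proof. by case: hL. Qed.

Notation real_elt := (real_elt p s).

Lemma real_elt_subspace : subspace_set real_elt.
Proof.
split=> [|x y [l1 ->] [l2 ->]|k x [l ->]]; first by exists [::]; rewrite /lin big_nil.
  by exists (l1 ++ l2); rewrite lin_cat.
exists [seq ((k * u.1.1, u.1.2), u.2) | u <- l].
rewrite /lin big_map scaler_sumr; apply: eq_bigr => u _.
by rewrite /term_val /= scalerA.
Qed.

Lemma real_elt_path a B : gen_vertices B -> real_elt (path_mul s a (p B)).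
Proof.
move=> gB; exists [:: (1, a, exist _ B gB)].
by rewrite /lin big_cons big_nil addr0 /term_val /= scale1r.
Qed.

Lemma real_elt_min (Q : set L) x : subspace_set Q ->
  (forall a B, gen_vertices B -> Q (path_mul s a (p B))) -> real_elt x -> Q x.
Proof.
move=> sQ pQ [l ->]; apply: subspace_sum => // u.
by case: sQ => _ _; apply; apply/pQ/svalP.
Qed.

Lemma subspace_preim_mull (Q : set L) a : subspace_set Q ->
  subspace_set [set x | Q (a ** x)].
Proof.
move=> [Q0 QD QZ]; split=> [|x y /= Qx Qy|k x /= Qx]; first by rewrite /= numulr0.
  by rewrite numulDr; apply: (QD).
by rewrite numulZr; apply: QZ.
Qed.

Lemma subspace_preim_mulr (Q : set L) a : subspace_set Q ->
  subspace_set [set x | Q (x ** a)].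
Proof.
move=> [Q0 QD QZ]; split=> [|x y /= Qx Qy|k x /= Qx]; first by rewrite /= numul0r.
  by rewrite numulDl; apply: (QD).
by rewrite numulZl; apply: QZ.
Qed.

Lemma real_elt_minl (Q : set L) b x : subspace_set Q ->
  (forall a B, gen_vertices B -> Q (b ** path_mul s a (p B))) ->
  real_elt x -> Q (b ** x).
Proof.
by move=> sQ; apply: (@real_elt_min [set y | Q (b ** y)]); apply: subspace_preim_mull.
Qed.

Lemma real_elt_minr (Q : set L) b x : subspace_set Q ->
  (forall a B, gen_vertices B -> Q (path_mul s a (p B) ** b)) ->
  real_elt x -> Q (x ** b).
Proof.
by move=> sQ; apply: (@real_elt_min [set y | Q (y ** b)]); apply: subspace_preim_mulr.
Qed.

Lemma real_elt_mulSl e x : real_elt x -> real_elt (s e ** x).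
Proof.
apply: real_elt_minl; first exact: real_elt_subspace.
by move=> a B gB; apply: (real_elt_path (e :: a)).
Qed.

Lemma real_elt0 : real_elt 0. Proof. by case: real_elt_subspace. Qed.

Lemma real_elt_mulPl B x : gen_vertices B -> real_elt x -> real_elt (p B ** x).
Proof.
move=> gB; apply: real_elt_minl; first exact: real_elt_subspace.
move=> [|e a] C gC /=.
  by rewrite (fam_PI fam) //; apply: (real_elt_path [::]); apply: gen_verticesI.
rewrite numulA (fam_PSE fam) //; case: ifP => _.
  exact: (real_elt_path (e :: a)).
by rewrite numul0r; apply: real_elt0.
Qed.

Lemma real_elt_mulPr B x : gen_vertices B -> real_elt x -> real_elt (x ** p B).
Proof.
move=> gB [l ->]; exists (termsI (exist _ B gB) l).
by rewrite -(lin_mulP fam).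
Qed.

Lemma real_elt_mulSr e x : real_elt x -> real_elt (x ** s e).
Proof.
apply: real_elt_minr; first exact: real_elt_subspace.
move=> a B gB /=; rewrite path_mulA (fam_PSE fam) //; case: ifP => _; last first.
  by rewrite path_mul0; apply: real_elt0.
rewrite -(fam_SP fam) -[s e ** _]/(path_mul s [:: e] (p (rng e))) -path_mul_cat.
by apply: real_elt_path; apply: gen_verticesr.
Qed.

(* Sums of elements [s_a p_B t_b] with [b] of length at most [m]. *)
Fixpoint ghost_elt (m : nat) : set L :=
  if m is m'.+1 then
    [set x | exists y (l : seq (edge G * L)),
       [/\ real_elt y, forall u, u \in l -> ghost_elt m' u.2
         & x = y + \sum_(u <- l) u.2 ** t u.1]]
  else real_elt.
Arguments ghost_elt : simpl never.

Lemma real_ghost m x : real_elt x -> ghost_elt m x.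
Proof.
by case: m => // m xR; exists x, [::]; split; rewrite // big_nil addr0.
Qed.

Lemma ghost_eltS m x : ghost_elt m x -> ghost_elt m.+1 x.
Proof.
elim: m x => [|m IHm] x; first exact: (real_ghost 1).
by move=> [y [l [yR lG ->]]]; exists y, l; split=> // u /lG /IHm.
Qed.

Lemma ghost_elt_le m n x : (m <= n)%N -> ghost_elt m x -> ghost_elt n x.
Proof.
by move=> /subnK <-; elim: (n - m)%N => // k IHk /IHk /ghost_eltS.
Qed.

Lemma ghost_elt_subspace m : subspace_set (ghost_elt m).
Proof.
have [R0 RD RZ] := real_elt_subspace.
elim: m => [//|m [G0 GD GZ]]; split; first exact: real_ghost.
  move=> _ _ [y1 [l1 [yR1 lG1 ->]]] [y2 [l2 [yR2 lG2 ->]]].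
  exists (y1 + y2), (l1 ++ l2); split; first exact: RD.
    by move=> u; rewrite mem_cat => /orP[/lG1|/lG2].
  by rewrite big_cat /= addrACA.
move=> k _ [y [l [yR lG ->]]]; exists (k *: y), [seq (u.1, k *: u.2) | u <- l]; split.
- exact: RZ.
- by move=> _ /mapP[u ul ->]; apply/GZ/lG.
- rewrite scalerDr scaler_sumr big_map; congr (_ + _); apply: eq_bigr => u _.
  by rewrite numulZl.
Qed.

Lemma ghost_elt_mulTr m e x : ghost_elt m x -> ghost_elt m.+1 (x ** t e).
Proof.
move=> xG; exists 0, [:: (e, x)]; split; first exact: real_elt0.
  by move=> u; rewrite inE => /eqP ->.
by rewrite big_cons big_nil addr0 add0r.
Qed.

Lemma ghost_elt_min m (Q : set L) x : subspace_set Q ->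
  (forall y, real_elt y -> Q y) ->
  (forall z e, ghost_elt m z -> Q (z ** t e)) -> ghost_elt m.+1 x -> Q x.
Proof.
move=> sQ RQ GQ [y [l [/RQ yQ lG ->]]]; have [_ QD _] := sQ; apply: (QD) => //.
rewrite big_seq; elim/big_ind: _ => [|a b|u /lG]; last exact: GQ.
  by case: sQ.
exact: (QD).
Qed.

Lemma ghost_elt_minl m (Q : set L) b x : subspace_set Q ->
  (forall y, real_elt y -> Q (b ** y)) ->
  (forall z e, ghost_elt m z -> Q (b ** (z ** t e))) ->
  ghost_elt m.+1 x -> Q (b ** x).
Proof.
by move=> sQ; apply: (@ghost_elt_min _ [set y | Q (b ** y)]); apply: subspace_preim_mull.
Qed.

Lemma ghost_elt_minr m (Q : set L) b x : subspace_set Q ->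
  (forall y, real_elt y -> Q (y ** b)) ->
  (forall z e, ghost_elt m z -> Q (z ** t e ** b)) ->
  ghost_elt m.+1 x -> Q (x ** b).
Proof.
by move=> sQ; apply: (@ghost_elt_min _ [set y | Q (y ** b)]); apply: subspace_preim_mulr.
Qed.

Lemma ghost_elt_mulSl m e x : ghost_elt m x -> ghost_elt m (s e ** x).
Proof.
elim: m x => [|m IHm] x; first exact: real_elt_mulSl.
apply: ghost_elt_minl; first exact: ghost_elt_subspace.
  by move=> y yR; apply: real_ghost; apply: real_elt_mulSl.
by move=> z f /IHm zG /=; rewrite numulA; apply: ghost_elt_mulTr.
Qed.

Lemma ghost_elt_mulPl m B x : gen_vertices B -> ghost_elt m x -> ghost_elt m (p B ** x).
Proof.
move=> gB; elim: m x => [|m IHm] x; first exact: real_elt_mulPl.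
apply: ghost_elt_minl; first exact: ghost_elt_subspace.
  by move=> y yR; apply: real_ghost; apply: real_elt_mulPl.
by move=> z f /IHm zG /=; rewrite numulA; apply: ghost_elt_mulTr.
Qed.

Lemma ghost_elt_mulPr m B x : gen_vertices B -> ghost_elt m x -> ghost_elt m (x ** p B).
Proof.
move=> gB; case: m => [|m]; first exact: real_elt_mulPr.
apply: ghost_elt_minr; first exact: ghost_elt_subspace.
  by move=> y yR; apply: real_ghost; apply: real_elt_mulPr.
move=> z f zG; rewrite -numulA (fam_TPE fam) //; case: ifP => _.
  exact: ghost_elt_mulTr.
by rewrite numulr0; apply: real_ghost; apply: real_elt0.
Qed.

Lemma ghost_elt_T e : ghost_elt 1 (t e).
Proof.
rewrite -(fam_PT fam); apply: ghost_elt_mulTr.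
exact: (real_elt_path [::] (gen_verticesr e)).
Qed.

Lemma ghost_elt_mulTl m e x : ghost_elt m x -> ghost_elt m.+1 (t e ** x).
Proof.
have RT y : real_elt y -> ghost_elt 1 (t e ** y).
  apply: real_elt_minl; first exact: ghost_elt_subspace.
  move=> [|f a] B gB /=.
    rewrite (fam_TPE fam) //; case: ifP => _; first exact: ghost_elt_T.
    by apply: real_ghost; apply: real_elt0.
  rewrite numulA (fam_TS fam); case: ifP => _; apply: real_ghost.
    by apply: real_elt_mulPl; [exact: gen_verticesr|exact: real_elt_path].
  by rewrite numul0r; apply: real_elt0.
elim: m x => [//|m IHm] x.
apply: ghost_elt_minl; first exact: ghost_elt_subspace.
  by move=> y /RT; apply: ghost_elt_le.
by move=> z f /IHm zG /=; rewrite numulA; apply: ghost_elt_mulTr.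
Qed.

(** Only left multiplication by generators is needed: the elements that map [Q] into itself from the
    left form a subalgebra containing the generators, hence are everything. So [Q] is itself a
    subalgebra containing the generators. *)
Lemma ghost_elt_exists x : exists m, ghost_elt m x.
Proof.
have [_ gen _] := hL.
pose Q : set L := [set x | exists m, ghost_elt m x].
have sQ : subspace_set Q.
  split=> [|y z [m yG] [n zG]|k y [m yG]].
  - by exists 0%N; apply: real_elt0.
  - exists (maxn m n); have [_ GD _] := ghost_elt_subspace (maxn m n); apply: (GD).
      by apply: ghost_elt_le yG; apply: leq_maxl.
    by apply: ghost_elt_le zG; apply: leq_maxr.
  - by exists m; case: (ghost_elt_subspace m) => _ _; apply.
have mulQ : [set y | forall z, Q z -> Q (y ** z)] = setT.
  apply: gen; first split; first split.
  - by move=> z _; rewrite numul0r; case: sQ.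
  - move=> y1 y2 Q1 Q2 z Qz; rewrite numulDl.
    by case: sQ => _ QD _; apply: (QD); [exact: Q1|exact: Q2].
  - by move=> k y Qy z Qz; rewrite numulZl; case: sQ => _ _; apply; apply: Qy.
  - by move=> y1 y2 Q1 Q2 z Qz; rewrite -numulA; apply/Q1/Q2.
  - by move=> C gC z [m zG]; exists m; apply: ghost_elt_mulPl.
  - move=> e; split=> z [m zG]; first by exists m; apply: ghost_elt_mulSl.
    by exists m.+1; apply: ghost_elt_mulTl.
suff : Q = setT by move=> QT; have : Q x by rewrite QT.
apply: gen; first split=> //.
- move=> y z _ Qz; have : [set y | forall z, Q z -> Q (y ** z)] y by rewrite mulQ.
  exact.
- by move=> C gC; exists 0%N; apply: (real_elt_path [::]).
- move=> e; split; last by exists 1%N; apply: ghost_elt_T.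
  exists 0%N; rewrite -(fam_SP fam); apply: (real_elt_path [:: e]).
  exact: gen_verticesr.
Qed.

(** Elements fixed by some [p B] on the right form a subalgebra, since unions of sets serve for
    sums. *)
Lemma local_unit x : exists2 B, gen_vertices B & x ** p B = x.
Proof.
have [_ gen _] := hL.
suff : [set x | exists2 B, gen_vertices B & x ** p B = x] = setT.
  move=> eT; have : [set x | exists2 B, gen_vertices B & x ** p B = x] x.
    by rewrite eT.
  by [].
apply: gen; first split; first split.
- by exists set0; [exact: gen_vertices0|rewrite numul0r].
- move=> y z [B gB yB] [C gC zC]; exists (B `|` C); first exact: gen_verticesU.
  rewrite -yB -zC numulDl -!numulA !(fam_PI fam) //; try exact: gen_verticesU.
  by rewrite !setIUr !setIid setUIr setUid; congr (_ ** p _ + _ ** p _);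
     apply/seteqP; split=> v /=; tauto.
- by move=> k y [B gB yB]; exists B; rewrite // numulZl yB.
- by move=> y z _ [B gB zB]; exists B; rewrite // -numulA zB.
- by move=> C gC; exists C; rewrite // (fam_PI fam) ?setIid.
- move=> e; split; first by exists (rng e); [exact: gen_verticesr|exact: (fam_SP fam)].
  by exists [set src e]; [exact: gen_vertices1|exact: (fam_TP fam)].
Qed.

(** Multiplying by [s e] or by [p [set src e]] retains the same terms, those whose set contains the
    source of [e]. *)
Lemma real_elt_independent y e : real_elt y -> y ** s e = 0 -> y ** p [set src e] = 0.
Proof.
move=> [l ->].
pose l' : seq (K * seq (edge G)) := [seq u.1 | u <- l & `[< sval u.2 (src e) >]].
have lE (z : L) : (forall B, gen_vertices B ->
      p B ** z = if `[< B (src e) >] then z else 0) ->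
    lin p s l ** z = \sum_(u <- l') u.1 *: path_mul s u.2 z.
  move=> pz; rewrite numul_suml big_map big_filter [RHS]big_mkcond.
  apply: eq_bigr => u _ ; rewrite /term_val numulZl path_mulA pz; last exact: svalP.
  by case: ifP; rewrite ?path_mul0 ?scaler0.
rewrite (lE _ (fun B gB => fam_PSE fam e gB)) (lE _ (fun B gB => fam_P1E fam _ gB)).
exact: (path_mul_independent hL).
Qed.

(** The edge [e0] and the finite list [r] ensure that [v] is nonsingular. *)
Lemma fam_CK (r : seq (edge G)) v e0 : uniq r -> e0 \in r -> src e0 = v ->
  (forall e, src e = v -> e \in r) ->
  p [set v] = \sum_(e <- r | src e == v) s e ** t e.
Proof.
move=> ur e0r e0v vr.
have vE : out_edges v = [set` [seq e <- r | src e == v]].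
  apply/seteqP; split=> e /=; rewrite mem_filter; last by case/andP => /eqP.
  by move=> ev; rewrite ev eqxx vr.
have [_ _ _ CK] := fam; rewrite CK.
  by rewrite vE -fsbig_seq ?filter_uniq // big_filter.
case=> [v0|]; first by have : out_edges v e0 by []; rewrite v0.
by apply; rewrite vE; apply: finite_seq.
Qed.

Variable I : set L.
Hypothesis idI : two_sided_ideal I.

(** Induction on the ghost length [m]. Multiplying by some [s e] lowers it, unless every [s e] kills
    [x] from the right; in that case [x] has a nonzero real multiple in [I]. *)
Lemma ideal_real_elt x : I x -> x <> 0 -> exists w, [/\ I w, w <> 0 & real_elt w].
Proof.
have [m] := ghost_elt_exists x; have [subI mulI] := idI.
elim: m x => [|m IHm] x; first by exists x.
move=> [y [l [yR lG xE]]] Ix xn0.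
have [[e xe]|xs] := pselect (exists e, x ** s e <> 0).
  apply: IHm xe; last by case: (mulI (s e) x Ix).
  rewrite xE numulDl; have [_ GD _] := ghost_elt_subspace m.
  apply: (GD); first exact/real_ghost/real_elt_mulSr.
  rewrite numul_suml big_seq; elim/big_ind: _ => [|a b|u /lG uG].
  - by apply: real_ghost; apply: real_elt0.
  - exact: (GD).
  - rewrite -numulA (fam_TS fam); case: ifP => _.
      by apply: ghost_elt_mulPr => //; apply: gen_verticesr.
    by rewrite numulr0; apply: real_ghost; apply: real_elt0.
have {}xs e : x ** s e = 0 by apply: contrapT => xe; apply: xs; exists e.
apply: contrapT => noreal.
have no w : I w -> real_elt w -> w = 0.
  by move=> Iw wR; apply: contrapT => wn0; apply: noreal; exists w.
pose r := undup (map fst l); have ur : uniq r := undup_uniq _.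
(* [Q] is the sum over the edges whose ghosts occur in [x]; it is a right unit for [x - y] and
   commutes with all [p B]. *)
pose Q := \sum_(e <- r) s e ** t e.
have tQ f : f \in r -> t f ** Q = t f.
  move=> fr; rewrite numul_sumr (bigD1_seq f) //= numulA (fam_TS fam) eqxx (fam_PT fam).
  rewrite big1 ?addr0 // => g /negbTE gf.
  by rewrite numulA (fam_TS fam) eq_sym gf numul0r.
have Qs e : e \notin r -> Q ** s e = 0.
  move=> er; rewrite numul_suml big1_seq // => f /andP[_ fr].
  rewrite -numulA (fam_TS fam); case: eqP => [fe|]; last by rewrite numulr0.
  by rewrite -fe fr in er.
have QP B : gen_vertices B -> Q ** p B = \sum_(e <- r | `[< B (src e) >]) s e ** t e.
  move=> gB; rewrite numul_suml [RHS]big_mkcond; apply: eq_bigr => e _.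
  by rewrite -numulA (fam_TPE fam) //; case: ifP; rewrite ?numulr0.
have PQ B : gen_vertices B -> p B ** Q = Q ** p B.
  move=> gB; rewrite QP // numul_sumr [RHS]big_mkcond; apply: eq_bigr => e _.
  by rewrite numulA (fam_PSE fam) //; case: ifP; rewrite ?numul0r.
have {}xE : x = y - y ** Q.
  have xQ : x ** Q = 0 by rewrite numul_sumr big1 // => e _; rewrite numulA xs numul0r.
  have xyQ : (x - y) ** Q = x - y.
    rewrite xE addrC addKr numul_suml big_seq [RHS]big_seq; apply: eq_bigr => u ul.
    by rewrite -numulA tQ // mem_undup map_f.
  by rewrite numulBl xQ sub0r in xyQ; rewrite xyQ addrC subrK.
(* If some edge at this source lies outside [r], it is orthogonal to [Q], so independence makes [y]
   vanish at the source. Otherwise the Cuntz-Krieger relation identifies [Q] with the unit there. *)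
have xv e : e \in r -> x ** p [set src e] = 0.
  move=> er; have g1 := gen_vertices1 (src e); rewrite xE numulBl -numulA.
  have [[f [fe fr]]|all_r] := pselect (exists f, src f = src e /\ f \notin r).
    have yv : y ** p [set src e] = 0.
      rewrite -fe; apply: real_elt_independent => //.
      by have := xs f; rewrite xE numulBl -numulA Qs // numulr0 subr0.
    by rewrite -PQ // numulA yv numul0r subr0.
  rewrite QP //.
  have -> : \sum_(f <- r | `[< [set src e] (src f) >]) s f ** t f
      = \sum_(f <- r | src f == src e) s f ** t f.
    by apply: eq_bigl => f; apply/asboolP/eqP.
  rewrite -(fam_CK ur er (erefl _)) ?subrr // => f fe.
  by apply: contrapT => fr; apply: all_r; exists f; split=> //; apply/negP.
(* The sources of the edges in [r] are removed from the set one by one, without changing the product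
   with [x]. *)
have xP (l' : seq (edge G)) : {subset l' <= r} ->
    (forall B, gen_vertices B -> (forall e, e \in l' -> ~ B (src e)) -> x ** p B = 0) ->
    forall B, gen_vertices B -> x ** p B = 0.
  elim: l' => [|e l' IHl'] lr xB B gB; first exact: xB.
  apply: IHl' gB => [f fl'|C gC Cl']; first by apply: lr; rewrite inE fl' orbT.
  have g1 := gen_vertices1 (src e).
  rewrite (fam_split fam gC g1) numulDr -(fam_PI fam) // (fam_P1E fam) //.
  rewrite [X in _ + X]xB; last 2 first.
  - exact: gen_verticesD.
  - by move=> f; rewrite inE => /orP[/eqP -> [_]|/Cl' nC []] //; apply.
  rewrite addr0; case: ifP => _; last exact: numulr0.
  by apply/xv/lr/mem_head.
have [B gB xB] := local_unit x; apply: xn0; rewrite -xB.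
apply: (xP r) gB => // C gC Cr.
(* Away from these sources [Q] vanishes, so [x] agrees there with the real element [y]. *)
have QC : Q ** p C = 0.
  rewrite QP // big1_seq // => e /andP[/asboolP Ce er]; case: (Cr e er Ce).
have xC : x ** p C = y ** p C by rewrite xE numulBl -numulA QC numulr0 subr0.
apply: no; first by case: (mulI (p C) x Ix).
by rewrite xC; apply: real_elt_mulPr.
Qed.

End GhostDegree.

(** * Simplicity *)

Section PointTails.
Variables (G : ultragraph) (H : set (set (vertex G))) (K : fieldType) (d : int).

Lemma iter_point_tail m (y : point G) :
  iter m (point_tail d) y = (fun j => y.1 (m + j)%N, y.2 - d *+ m).
Proof.
elim: m => [|m IHm]; first by rewrite subr0; case: y.
rewrite iterS IHm /point_tail /= mulrSr opprD addrA; congr pair.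
by apply/funext => j; rewrite /tail addnS.
Qed.

Lemma path_mul_pointE e a (z : endofun K (point G)) phi y :
  boundary H y.1 ->
  (forall k, (k < size a)%N -> y.1 k = inl (nth e a k)) ->
  path_mul (pointS H K d) a z phi y = z phi (iter (size a) (point_tail d) y).
Proof.
elim: a y => [//|f a IHa] y by_ ya.
rewrite iterSr -IHa /=; last 2 first.
- exact: boundary_tail.
- by move=> k ka; apply: (ya k.+1).
by rewrite asboolT //; split=> //; apply: (ya 0%N).
Qed.

End PointTails.

Section Simplicity.
Variables (G : ultragraph) (K : fieldType) (L : nuAlgType K).
Variables (p : set (vertex G) -> L) (s t : edge G -> L).
Hypothesis hL : is_leavitt_path_algebra p s t.

Let fam : leavitt_family p s t. Proof. by case: hL. Qed.

Lemma kernel_ideal (A : nuAlgType K) (f : {linear L -> A}) :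
  multiplicative_map f -> two_sided_ideal [set x | f x = 0].
Proof.
move=> fM; split; first split=> [|x y /= fx fy|k x /= fx].
- exact: linear0.
- by rewrite linearD fx fy addr0.
- by rewrite linearZ_LR fx scaler0.
- by move=> a x /= fx; rewrite !fM fx numulr0 numul0r.
Qed.

Lemma pointP_neq0 H (f : L -> endofun K (point G)) B :
  H set0 -> hereditary H -> saturated H ->
  (forall C, gen_vertices C -> f (p C) = pointP H K C) ->
  gen_vertices B -> ~ H B -> f (p B) <> 0 :> endofun K (point G).
Proof.
move=> H0 hH sH fp gB nHB; rewrite fp // => fB0.
have [x bx xB] := exists_boundary H0 hH sH gB nHB.
have : pointP H K B (fun=> 1) (x, 0) = 0 by rewrite fB0.
by rewrite /= asboolT // => /eqP; rewrite oner_eq0.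
Qed.

Lemma leavitt_p_neq0 B : gen_vertices B -> B !=set0 -> p B <> 0.
Proof.
move=> gB [v Bv] pB0.
have [f [_ fp _]] := leavitt_morphism hL 0 (erefl _) (@hereditary1 G) (@saturated1 G).
apply: (pointP_neq0 (erefl _) (@hereditary1 G) (@saturated1 G) fp gB).
  by move=> /= B0; rewrite B0 in Bv.
by rewrite pB0 linear0.
Qed.

(** The kernel of the representation built from [H] contains [p B] exactly for [B] in [H], and by
    simplicity it is zero or everything. If zero, [H] has only the empty set as a member. *)
Lemma simple_hereditary H : simple_algebra L -> H `<=` @gen_vertices G ->
  hereditary H -> saturated H ->
  [\/ H = @gen_vertices G, H = set0 | H = [set set0]].
Proof.
move=> sL HG hH sH.
have [->|/set0P[B0 HB0]] := eqVneq H set0; first by apply: Or32.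
have H0 : H set0.
  by case: hH => _ _ /(_ B0 set0 HB0); apply; [exact: gen_vertices0|].
have [f [fM fp _]] := leavitt_morphism hL 0 H0 hH sH.
have fpH B : gen_vertices B -> f (p B) = 0 -> H B.
  move=> gB fB; apply: contrapT => nHB.
  exact: (pointP_neq0 H0 hH sH fp gB nHB fB).
have [k0|kT] := sL _ (kernel_ideal fM).
  apply: Or33; apply/seteqP; split=> [B HB|_ -> //] /=.
  apply: contrapT => /eqP/set0P Bn0; apply: (leavitt_p_neq0 (HG _ HB) Bn0).
  suff : [set x | f x = 0] (p B) by rewrite k0.
  rewrite /= fp; last exact: HG.
  apply: endofunP => phi x /=; case: asboolP => // -[bx xB].
  by case: (admissible_base hH (bx 0%N).1 HB).
apply: Or31; apply/seteqP; split=> // B gB; apply: fpH => //.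
by have : [set x | f x = 0] (p B) by rewrite kT.
Qed.

(** Without exits and sinks, each range on the cycle is the single source of the next edge, which is
    the only edge leaving it. So a boundary point that starts on the cycle can neither end nor
    leave. *)
Lemma cycle_boundary n (a : 'I_n.+1 -> edge G) x i :
    is_cycle a -> ~ (exists e, is_exit a e) ->
    ~ (exists i w, rng (a i) w /\ sink w) ->
    boundary [set set0] x -> base (x 0%N) [set src (a i)] ->
  forall k, x k = inl (a (iter k (@ordS n.+1) i)).
Proof.
move=> cyc nexit nsink bx xi.
have rE j : rng (a j) = [set src (a (ordS j))].
  apply/seteqP; split=> [w jw|_ ->]; last exact: cyc.
  have [e we] : out_edges w !=set0.
    by apply/set0P/eqP => w0; apply: nsink; exists j, w.
  have -> : a (ordS j) = e.
    apply: contrapT => ne; apply: nexit; exists e, j; rewrite we.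
    by split=> // ae; apply: ne.
  by rewrite -we.
have outE j e : src e = src (a j) -> e = a j.
  move=> ej; apply: contrapT => ne; apply: nexit; exists e, (ord_pred j).
  by rewrite ord_predK ej; split=> //; rewrite -{2}(ord_predK j); apply: cyc.
have nsing j : ~ singular (src (a j)).
  have oE : out_edges (src (a j)) = [set a j].
    by apply/seteqP; split=> [e /outE|_ ->].
  case; rewrite oE; first by move/seteqP => -[/(_ (a j) (erefl _))].
  by apply; exact: finite_set1.
have xE k : base (x k) [set src (a (iter k (@ordS n.+1) i))] ->
    x k = inl (a (iter k (@ordS n.+1) i)).
  have [+ _] := bx k; case: (x k) => [e _ /outE -> //|U [_ _ Uns]].
  by move=> /(Uns _ (@nsing _)).
elim=> [|k IHk]; first exact: xE.
by apply: xE; have [_ /(_ _ IHk)] := bx k; rewrite rE.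
Qed.

Lemma simple_conditionL : simple_algebra L -> conditionL G.
Proof.
move=> sL n a cyc; apply: contrapT => /not_orP[nexit nsink].
pose i0 : 'I_n.+1 := ord0; pose v := src (a i0).
have H1 := @hereditary1 G; have S1 := @saturated1 G.
have nHv : ~ [set set0] [set v] by move=> /= /seteqP[/(_ v (erefl _))].
have [x bx xv] := exists_boundary (erefl _) H1 S1 (gen_vertices1 v) nHv.
pose c k := a (iter k (@ordS n.+1) i0).
have xE k : x k = inl (c k) by apply: cycle_boundary bx xv k.
have cyc_uniq y : boundary [set set0] y -> base (y 0%N) [set v] -> y = x.
  by move=> by_ yv; apply/funext => k; rewrite xE; apply: cycle_boundary by_ yv k.
have iterE k : iter k (@ordS n.+1) i0 = (k %% n.+1)%N :> nat.
  elim: k => [|k IHk]; first by rewrite mod0n.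
  by rewrite iterS /= IHk -addn1 modnDml addn1.
have cper k : c (n.+1 + k)%N = c k.
  by rewrite /c; congr a; apply: ord_inj; rewrite !iterE modnDl.
pose w := mkseq c n.+1.
(* A full turn returns to the same boundary path and changes only the degree, by [d *+ n.+1]. *)
have pathE d (z : endofun K (point G)) phi k :
    path_mul (pointS [set set0] K d) w z phi (x, k) = z phi (x, k - d *+ n.+1).
  rewrite (path_mul_pointE _ (e := c 0%N)) //; last first.
    by move=> j; rewrite size_mkseq => jn; rewrite nth_mkseq.
  rewrite size_mkseq iter_point_tail; congr (z phi (_, _)).
  by apply/funext => j /=; rewrite !xE cper.
have [f0 [f0M f0p f0s]] := leavitt_morphism hL 0 (erefl _) H1 S1.
have [f1 [f1M f1p f1s]] := leavitt_morphism hL 1 (erefl _) H1 S1.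
have g1 := gen_vertices1 v.
(* For [d = 0] a full turn acts as the identity, and the kernel is zero by simplicity. *)
have pw : path_mul s w (p [set v]) = p [set v].
  apply/eqP; rewrite -subr_eq0; apply/eqP.
  have [k0|kT] := sL _ (kernel_ideal f0M); last first.
    case: (pointP_neq0 (erefl _) H1 S1 f0p g1 nHv).
    by have : [set x | f0 x = 0] (p [set v]) by rewrite kT.
  suff fpw : f0 (path_mul s w (p [set v])) = f0 (p [set v]).
    have : [set x | f0 x = 0] (path_mul s w (p [set v]) - p [set v]).
      by rewrite /= linearB fpw subrr.
    by rewrite k0.
  rewrite (morph_path_mul _ _ f0M (fun e => (f0s e).1)) f0p //.
  apply: endofunP => phi [y k].
  have [[by_ yv]|ny] := pselect (boundary [set set0] y /\ base (y 0%N) [set v]).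
    by rewrite (cyc_uniq y) // pathE mul0rn subr0.
  rewrite [RHS]/= asboolF // /w /mkseq /=; case: asboolP => // -[by_ y0].
  by case: ny; split=> //; rewrite [y 0%N]y0.
(* For [d = 1] the degree tells the two sides of [pw] apart. *)
pose delta (y : point G) : K := if `[< y = (x, 0) >] then 1 else 0.
have : f1 (path_mul s w (p [set v])) delta (x, 0) = f1 (p [set v]) delta (x, 0).
  by rewrite pw.
rewrite (morph_path_mul _ _ f1M (fun e => (f1s e).1)) pathE f1p //=.
rewrite /delta [in RHS]asboolT // [in RHS]asboolT // sub0r.
case: asboolP => _; last by move/eqP; rewrite eq_sym oner_eq0.
case: asboolP => [[/eqP]|_]; last by move/eqP; rewrite eq_sym oner_eq0.
by rewrite oppr_eq0 Num.Theory.pnatr_eq0.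
Qed.

(** The sets [B] with [p B] in [I] form a saturated hereditary family, the saturation coming from
    the Cuntz-Krieger relation. Either it contains everything, and [I] contains all generators, or a
    nonzero element of [I] would put a nonempty set in it. *)
Lemma conditionL_simple : conditionL G ->
  (forall H : set (set (vertex G)), H `<=` @gen_vertices G ->
     hereditary H -> saturated H ->
     [\/ H = @gen_vertices G, H = set0 | H = [set set0]]) ->
  simple_algebra L.
Proof.
move=> condL noH I idI; have [subI mulI] := idI; have [I0 ID IZ] := subI.
pose H : set (set (vertex G)) := [set B | gen_vertices B /\ I (p B)].
have hH : hereditary H.
  split=> [e [_ Ie]|B C [gB IB] [gC IC]|B C [gB IB] gC CB].
  - split; first exact: gen_verticesr.
    have -> : p (rng e) = t e ** (p [set src e] ** s e).
      by rewrite (fam_PS fam) (fam_TS fam) eqxx.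
    by case: (mulI (s e) _ Ie) => _ Ise; case: (mulI (t e) _ Ise).
  - split; first exact: gen_verticesU.
    rewrite (fam_PU fam) // -(fam_PI fam) //; apply: subspaceB => //; first exact: ID.
    by case: (mulI (p C) _ IB).
  - split=> //; rewrite -(setIidr CB) -(fam_PI fam) //.
    by case: (mulI (p C) _ IB).
have sH : saturated H.
  move=> v nv vH; split; first exact: gen_vertices1.
  have [_ _ _ CK] := fam; have [r ur vr] := not_singular_seq nv.
  rewrite CK // vr -fsbig_seq // big_seq.
  elim/big_ind: _ => [//|x y|e er]; first exact: (ID).
  have [_ Ir] : H (rng e).
    by apply: vH; exists e => //; rewrite vr.
  by rewrite -(fam_SP fam); case: (mulI (s e) _ Ir) => /(mulI (t e))[_].
have [HE|HE|HE] := noH H (fun B HB => HB.1) hH sH.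
- right; have [_ gen _] := hL.
  have Ip C : gen_vertices C -> I (p C) by rewrite -HE => -[].
  apply: gen => //; first by split=> // x y _ Iy; case: (mulI x y Iy).
  move=> e; have Ir := Ip _ (gen_verticesr e).
  split; first by rewrite -(fam_SP fam); case: (mulI (s e) _ Ir).
  by rewrite -(fam_PT fam); case: (mulI (t e) _ Ir).
- have : H set0 by split; [exact: gen_vertices0|rewrite (fam_P0 fam)].
  by rewrite HE.
left; apply/seteqP; split=> [x Ix|_ -> //] /=; apply: contrapT => xn0.
have [w [Iw wn0 wR]] := ideal_real_elt hL idI Ix xn0.
have [B [gB [v Bv] IB]] := conditionL_ideal_vertices fam idI condL Iw wn0 wR.
have : H B by [].
by rewrite HE /= => B0; rewrite B0 in Bv.
Qed.

End Simplicity.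

Theorem theorem11p3 (G : ultragraph) (K : fieldType) (L : nuAlgType K)
    (p : set (vertex G) -> L) (s t : edge G -> L)
    (hL : is_leavitt_path_algebra p s t) :
  simple_algebra L <->
  conditionL G /\
  (forall H : set (set (vertex G)), H `<=` @gen_vertices G ->
     hereditary H -> saturated H ->
     [\/ H = @gen_vertices G, H = set0 | H = [set set0]]).
Proof.
split=> [sL|[condL noH]]; last exact: (conditionL_simple hL).
by split; [exact: (simple_conditionL hL)|move=> H; exact: (simple_hereditary hL)].
Qed.
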